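(* Let $\mu$ be a unimodular probability measure on $\mathcal G_\ast$ of bounded degree, i.e. there is $D\in\mathbb N$ such that for $\mu$-a.e. $[G,o]$ one has $\deg_G(v)\le D$ for all $v\in V(G)$, and let $(f,h,\psi)$ be an admissible potential triple for $\mu$ (as defined in the context). Then the potential functional $$\Phi(x)=\int_{\mathcal G_\ast}\bigg[f\big([G,o],x([G,o])\big)+\frac12\sum_{v\sim o}\psi\big([G,o,v],x([G,o]),x([G,v])\big)\bigg]\mu(d[G,o])$$ is finite for every $x\in\mathcal H=L^2(\mu,H)$.
   Context: Graphs. All graphs $G=(V,E)$ are simple (undirected, no loops or multiple edges), locally finite, with finite or countably infinite vertex set $V=V(G)$; $u\sim v$ means $\{u,v\}\in E$. A rooted graph $(G,o)$ is a graph with a distinguished vertex $o$; rooted isomorphisms are graph isomorphisms mapping root to root, and $[G,o]$ is the isomorphism class. $B_r(G,o)$ is the rooted subgraph induced by the vertices at graph distance at most $r$ from $o$. $\mathcal G_\ast$ is the set of isomorphism classes of countable, connected, rooted graphs with metric $d_\ast([G,o],[G',o'])=\inf_{r\in\mathbb N_0}\{2^{-r}:B_r(G,o)\cong B_r(G',o')\}$. $\mathcal G_{\ast\ast}$ is the analogous space of isomorphism classes $[G,o_1,o_2]$ of countable, connected, doubly rooted graphs (isomorphisms preserve both roots in order), with the analogous metric $d_{\ast\ast}$. Both carry Borel $\sigma$-fields. A probability measure $\mu$ on $\mathcal G_\ast$ is unimodular if for every measurable $T:\mathcal G_{\ast\ast}\to[0,\infty]$, $\int\sum_{v\in V(G)}T([G,o,v])\,\mu(d[G,o])=\int\sum_{v\in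 V(G)}T([G,v,o])\,\mu(d[G,o])$. Spaces. $H$ is a separable real Hilbert space, and $\mathcal H=L^2(\mu,H)$ is the Hilbert space of measurable $x:\mathcal G_\ast\to H$ with $\|x\|_{\mathcal H}^2=\int\|x([G,o])\|_H^2\,\mu(d[G,o])<\infty$. Admissible potential triple. Measurable functions $f:\mathcal G_\ast\times H\to\mathbb R$ (private cost), $h:\mathcal G_{\ast\ast}\times H\times H\to\mathbb R$ (interaction cost) and $\psi:\mathcal G_{\ast\ast}\times H\times H\to\mathbb R$ form an admissible potential triple for $\mu$ if the following hold ($\nabla$ is the Gâteaux gradient; $\nabla_1,\nabla_2$ are partial gradients in the first and second $H$-argument). (i) For $\mu$-a.e. $[G,o]$, $a\mapsto f([G,o],a)$ is Gâteaux differentiable on $H$. (ii) For $\mu$-a.e. $[G,o]$ and every $v\sim o$: $a\mapsto h([G,o,v],a,b)$ is Gâteaux differentiable on $H$ for every $b\in H$; $(a,b)\mapsto\psi([G,o,v],a,b)$ is Gâteaux differentiable on $H\times H$; and for all $a,b\in H$, $\nabla_1\psi([G,o,v],a,b)=\nabla_1h([G,o,v],a,b)$ and $\nabla_2\psi([G,o,v],a,b)=\nabla_1h([G,v,o],b,a)$. (iii) There are constants $L_f,L_h\ge0$ such that for $\mu$-a.e. $[G,o]$, every $v\sim o$ and all $a,a',b,b'\in H$: $\|\nabla f([G,o],a)-\nabla f([G,o],a')\|_H\le L_f\|a-a'\|_H$ and $\|\nabla_1h([G,o,v],a,b)-\nabla_1h([G,o,v],a',b')\|_H\le L_h(\|a-a'\|_H+\|b-b'\|_H)$.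 (iv) There is $a_\ast\in H$ such that the functions $|f([G,o],a_\ast)|$, $\|\nabla f([G,o],a_\ast)\|_H^2$, $\sum_{v\sim o}|\psi([G,o,v],a_\ast,a_\ast)|$ and $\sum_{v\sim o}\|\nabla_1h([G,o,v],a_\ast,a_\ast)\|_H^2$ of $[G,o]$ all have finite $\mu$-integral. *)

(* Defs.v *)
From HB Require Import structures.
From mathcomp Require Import all_boot all_order all_algebra.
From mathcomp Require Import all_classical all_reals all_analysis.
Import Order.TTheory GRing.Theory Num.Theory.
From mathcomp Require Import measurable_realfun lra generic_quotient.
Import numFieldNormedType.Exports.

Set Implicit Arguments.
Unset Strict Implicit.
Unset Printing Implicit Defensive.

Local Open Scope classical_set_scope.
Local Open Scope ring_scope.

(* Every finite or countably infinite graph is isomorphic to one whose vertex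
   set is a subset of nat, so only these are used as representatives. *)
Record graph := Graph {
  vert : {pred nat};
  adj : rel nat;
  adj_sym : symmetric adj;
  adj_irr : irreflexive adj;
  adj_vert : forall u v, adj u v -> (u \in vert) && (v \in vert) }.

Definition vertex (G : graph) := {v : nat | v \in vert G}.

(* The graph distance from u to v is at most r. *)
Definition dist_le (G : graph) (r u v : nat) : Prop :=
  exists p : seq nat, [/\ path (adj G) u p, last u p = v & (size p <= r)%N].

Definition graph_connected (G : graph) : Prop :=
  forall u v : vertex G, exists r, dist_le G r (val u) (val v).

Definition nbrs (G : graph) (v : vertex G) : set (vertex G) :=
  [set u | adj G (val v) (val u)].

Definition locally_finite (G : graph) : Prop :=
  forall v : vertex G, finite_set (nbrs v).

Section Ball.
Variables (G : graph) (s : seq nat) (r : nat).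

Definition ball_vert : {pred nat} :=
  [pred v | (v \in vert G) && `[< exists2 o, o \in s & dist_le G r o v >] ].

Definition ball_adj : rel nat := [rel u v | [&& adj G u v, u \in ball_vert & v \in ball_vert]].

Lemma ball_adj_sym : symmetric ball_adj.
Proof. by move=> u v; rewrite /ball_adj /= adj_sym [X in _ && X]andbC. Qed.

Lemma ball_adj_irr : irreflexive ball_adj.
Proof. by move=> u; rewrite /ball_adj /= adj_irr. Qed.

Lemma ball_adj_vert u v : ball_adj u v -> (u \in ball_vert) && (v \in ball_vert).
Proof. by case/andP. Qed.

(* Subgraph induced by the vertices at distance at most r from some vertex
   of s. *)
Definition ball_graph : graph := Graph ball_adj_sym ball_adj_irr ball_adj_vert.

End Ball.

(* f is an isomorphism from G to G' mapping the list of roots s to s', in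
   order. *)
Definition is_root_iso (f : nat -> nat) (G : graph) (s : seq nat)
    (G' : graph) (s' : seq nat) : Prop :=
  [/\ set_bij [set` vert G] [set` vert G'] f,
      {in vert G &, forall u v, adj G' (f u) (f v) = adj G u v} &
      map f s = s'].

Definition root_iso G s G' s' := exists f, is_root_iso f G s G' s'.

(* Connected locally finite graphs with k ordered, not necessarily distinct,
   roots. *)
Record lgraph := LGraph {
  lgraph_graph :> graph;
  lgraph_connected : graph_connected lgraph_graph;
  lgraph_finite : locally_finite lgraph_graph }.

Record rgraph (k : nat) := RGraph {
  rgraph_lgraph :> lgraph;
  roots : k.-tuple (vertex rgraph_lgraph) }.

Definition root_seq k (G : rgraph k) : seq nat := map val (roots G).

Definition rgraph_iso k (G G' : rgraph k) : Prop :=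
  root_iso G (root_seq G) G' (root_seq G').

Definition ball_iso k (r : nat) (G G' : rgraph k) : Prop :=
  root_iso (ball_graph G (root_seq G) r) (root_seq G)
           (ball_graph G' (root_seq G') r) (root_seq G').

Lemma root_iso_refl G s : root_iso G s G s.
Proof.
exists id; split => //; last by rewrite map_id.
by split => //= x Hx; exists x.
Qed.

Lemma is_root_iso_inv f G s G' s' : {subset s <= vert G} ->
  is_root_iso f G s G' s' ->
  exists2 g, is_root_iso g G' s' G s & {in vert G, cancel f g}.
Proof.
move=> sG [[/= fG finj fsurj] fadj fs].
have gP v : exists u, v \in vert G' -> u \in vert G /\ f u = v.
  case: (boolP (v \in vert G')) => [/fsurj[u uG <-]|_]; last by exists 0%N.
  by exists u.
have [g gK] := choice gP.
have fgK : {in vert G, cancel f g}.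
  move=> u uG; have [gG fg] := gK _ (fG _ uG).
  by apply: finj => //; rewrite inE.
exists g => //; split.
- split => /=.
  + by move=> v /gK[].
  + by move=> u v; rewrite !inE /= => /gK[_ {2}<-] /gK[_ {2}<-] ->.
  + by move=> u uG; exists (f u); [exact: fG | exact: fgK].
- move=> u v /gK[gu {2}<-] /gK[gv {2}<-].
  by rewrite fadj.
- rewrite -fs -map_comp -[RHS]map_id; apply/eq_in_map => u us /=.
  exact/fgK/sG.
Qed.

Lemma root_iso_sym G s G' s' : {subset s <= vert G} ->
  root_iso G s G' s' -> root_iso G' s' G s.
Proof. by move=> sG [f /(is_root_iso_inv sG)[g ? _]]; exists g. Qed.

Lemma root_iso_trans G s G' s' G'' s'' :
  root_iso G s G' s' -> root_iso G' s' G'' s'' -> root_iso G s G'' s''.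
Proof.
move=> [f [fb fadj <-]] [g [gb gadj <-]]; exists (g \o f); split.
- exact: set_bij_comp fb gb.
- move=> u v uG vG /=; have [/= fG _ _] := fb.
  by rewrite gadj ?fadj //; exact: fG.
- by rewrite map_comp.
Qed.

Lemma root_seq_vert k (G : rgraph k) : {subset root_seq G <= vert G}.
Proof. by move=> _ /mapP[v _ ->]; exact: valP. Qed.

Lemma rgraph_iso_refl k (G : rgraph k) : rgraph_iso G G.
Proof. exact: root_iso_refl. Qed.

Lemma rgraph_iso_sym k (G G' : rgraph k) : rgraph_iso G G' -> rgraph_iso G' G.
Proof. exact/root_iso_sym/root_seq_vert. Qed.

Lemma rgraph_iso_trans k (G G' G'' : rgraph k) :
  rgraph_iso G G' -> rgraph_iso G' G'' -> rgraph_iso G G''.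
Proof. exact: root_iso_trans. Qed.

Lemma dist_le_path G r o p : path (adj G) o p -> (size p <= r)%N ->
  {in p, forall v, dist_le G r o v}.
Proof.
move=> pp pr v vp; case/path.splitP: vp pp pr => p1 p2.
rewrite cat_path size_cat => /andP[pp1 _] pr; exists (rcons p1 v); split=> //.
- by rewrite last_rcons.
- exact: leq_trans (leq_addr _ _) pr.
Qed.

Lemma ball_root G s r : {subset s <= vert G} ->
  {subset s <= vert (ball_graph G s r)}.
Proof.
move=> sG o os; rewrite inE /= sG //=; apply/asboolP; exists o => //.
by exists [::].
Qed.

Lemma vert_ballP G s r v :
  reflect (v \in vert G /\ exists2 o, o \in s & dist_le G r o v)
          (v \in vert (ball_graph G s r)).
Proof.
by rewrite inE /=; apply: (iffP andP) => -[?] /asboolP ?; split => //;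
  apply/asboolP.
Qed.

Lemma vert_ball_le G s r r' : (r' <= r)%N ->
  {subset vert (ball_graph G s r') <= vert (ball_graph G s r)}.
Proof.
move=> rr v /vert_ballP[vG [ o os [p [pp pl pr]]]]; apply/vert_ballP; split => //.
by exists o => //; exists p; split => //; exact: leq_trans rr.
Qed.

Lemma adj_ballE G s r u v : u \in vert (ball_graph G s r) ->
  v \in vert (ball_graph G s r) -> adj (ball_graph G s r) u v = adj G u v.
Proof. by move=> uB vB; apply/and3P/idP => [[]|]. Qed.

Lemma path_vert G o p : o \in vert G -> path (adj G) o p -> {subset p <= vert G}.
Proof.
elim: p o => [|u p IH] o oG //= /andP[/adj_vert/andP[_ uG] /(IH _ uG) pG] v.
by rewrite inE => /orP[/eqP->|/pG].
Qed.

Lemma is_root_iso_ball_sub f G s G' s' r r' : {subset s <= vert G} ->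
  (r' <= r)%N ->
  is_root_iso f (ball_graph G s r) s (ball_graph G' s' r) s' ->
  {in vert (ball_graph G s r'), forall v, f v \in vert (ball_graph G' s' r')}.
Proof.
move=> sG rr [[/= fG _ _] fadj fs] v vB; have := vB => /vert_ballP[_ [ o os]].
move=> [p [pp pl pr]].
have oG := ball_root r sG os.
have pB : {subset p <= vert (ball_graph G s r)}.
  move=> u up; apply/vert_ballP; split; first exact: path_vert (sG _ os) pp _ up.
  by exists o => //; apply: dist_le_path pp (leq_trans pr rr) _ up.
apply/vert_ballP; split.
  by have /fG/vert_ballP[] := vert_ball_le rr vB.
exists (f o); first by rewrite -fs map_f.
exists (map f p); split; last by rewrite size_map.
  elim: p o {os pl pr} pp oG pB => [//|u p IH] o /= /andP[ou pp] oB pB.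
  have uB : u \in vert (ball_graph G s r) by apply: pB; rewrite mem_head.
  rewrite IH // ?andbT; last by move=> w wp; apply: pB; rewrite inE wp orbT.
  have ouB : adj (ball_graph G s r) o u by apply/and3P; split.
  by have /andP[] := etrans (fadj _ _ oB uB) ouB.
by rewrite last_map pl.
Qed.

Lemma ball_iso_le k r r' (G G' : rgraph k) : (r' <= r)%N ->
  ball_iso r G G' -> ball_iso r' G G'.
Proof.
move=> rr [f fi]; exists f.
have sG := @root_seq_vert _ G; have sG' := @root_seq_vert _ G'.
have [g gi fgK] := is_root_iso_inv (ball_root r sG) fi.
have fB := is_root_iso_ball_sub sG rr fi.
have gB := is_root_iso_ball_sub sG' rr gi.
case: (fi) => -[fG finj fsurj] fadj fs; split => //.
- split => /=.
  + exact: fB.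
  + move=> u v; rewrite !inE /= => uB vB; apply: finj; rewrite inE /=;
      exact: vert_ball_le rr _ _.
  + move=> w wB; exists (g w); first exact: gB.
    have [u uB uw] := fsurj _ (vert_ball_le rr wB).
    by rewrite -uw fgK.
- move=> u v uB vB; rewrite !adj_ballE ?fB //.
  have := fadj _ _ (vert_ball_le rr uB) (vert_ball_le rr vB).
  rewrite !adj_ballE //; try exact: (vert_ball_le rr).
    exact/fG/(vert_ball_le rr).
  exact/fG/(vert_ball_le rr).
Qed.

Lemma ball_iso_refl k r (G : rgraph k) : ball_iso r G G.
Proof. exact: root_iso_refl. Qed.

Lemma ball_iso_sym k r (G G' : rgraph k) : ball_iso r G G' -> ball_iso r G' G.
Proof. exact/root_iso_sym/ball_root/root_seq_vert. Qed.

Lemma ball_iso_trans k r (G G' G'' : rgraph k) :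
  ball_iso r G G' -> ball_iso r G' G'' -> ball_iso r G G''.
Proof. exact: root_iso_trans. Qed.

HB.instance Definition _ k := gen_eqMixin (rgraph k).
HB.instance Definition _ k := gen_choiceMixin (rgraph k).

Definition rgraph_isob k : rel (rgraph k) := fun G G' => `[< rgraph_iso G G' >].

Lemma rgraph_isob_refl k : reflexive (@rgraph_isob k).
Proof. by move=> G; apply/asboolP/rgraph_iso_refl. Qed.

Lemma rgraph_isob_sym k : symmetric (@rgraph_isob k).
Proof.
by move=> G G'; apply/asboolP/asboolP; exact: rgraph_iso_sym.
Qed.

Lemma rgraph_isob_trans k : transitive (@rgraph_isob k).
Proof.
by move=> G G' G'' /asboolP i /asboolP j; apply/asboolP/(rgraph_iso_trans i j).
Qed.

Canonical rgraph_equiv k := EquivRel (@rgraph_isob k)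
  (@rgraph_isob_refl k) (@rgraph_isob_sym k) (@rgraph_isob_trans k).

(* R, the field of the radii of metric balls, is phantom: it only lets the
   metric structure over R be inferred. *)
Definition rspace (R : realType) (k : nat) : Type :=
  {eq_quot (rgraph_equiv k)}%qT.

HB.instance Definition _ R k := Choice.on (rspace R k).

Definition class_of (R : realType) k (G : rgraph k) : rspace R k :=
  (\pi_({eq_quot (rgraph_equiv k)}%qT) G)%qT.

Definition representative (R : realType) k (q : rspace R k) : rgraph k :=
  repr (q : {eq_quot (rgraph_equiv k)}%qT).

Lemma representativeK (R : realType) k (q : rspace R k) :
  class_of R (representative q) = q.
Proof. exact: reprK. Qed.

Lemma class_ofP (R : realType) k (G G' : rgraph k) :
  class_of R G = class_of R G' <-> rgraph_iso G G'.
Proof. by split=> [/eqmodP/asboolP|i] //; apply/eqmodP/asboolP. Qed.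

Section Metric.
Variables (R : realType) (k : nat).
Implicit Types q : rspace R k.

(* As the value +oo (the infimum of the empty set) is attained for k = 2, e.g.
   when the roots coincide in exactly one of the graphs, rdist is
   extended-real-valued. *)
Definition rdist q q' : \bar R :=
  ereal_inf [set ((2 ^- r)%:E)%E | r in
    [set r : nat | ball_iso r (representative q) (representative q')]].

Definition rball q (e : R) : set (rspace R k) :=
  [set q' | (rdist q q' < e%:E)%E].

Lemma rballP q e q' : rball q e q' <->
  exists2 r, ball_iso r (representative q) (representative q') & 2 ^- r < e.
Proof.
split=> [/ereal_inf_lt[_ [r ri <-]]|[r ri re]].
  by rewrite lte_fin => ?; exists r.
rewrite /rball /=; apply: (@le_lt_trans _ _ (2 ^- r)%:E); last by rewrite lte_fin.
by apply: ereal_inf_lbound; exists r.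
Qed.

Lemma rball_center q (e : R) : 0 < e -> rball q e q.
Proof.
move=> e0; apply/rballP.
have [r re] := filter_ex (near_infty_natSinv_expn_lt (PosNum e0)).
exists r; first exact: ball_iso_refl.
by rewrite div1r in re.
Qed.

Lemma rball_sym q q' (e : R) : rball q e q' -> rball q' e q.
Proof. by move=> /rballP[r /ball_iso_sym ri re]; apply/rballP; exists r. Qed.

Lemma rball_triangle q q' q'' e e' :
  rball q e q' -> rball q' e' q'' -> rball q (e + e') q''.
Proof.
move=> /rballP[r ri re] /rballP[r' ri' re']; apply/rballP.
exists (minn r r').
  apply: (@ball_iso_trans _ _ _ (representative q')).
    exact: ball_iso_le (geq_minl _ _) ri.
  exact: ball_iso_le (geq_minr _ _) ri'.
have p0 n : 0 < 2 ^- n :> R by rewrite invr_gt0 exprn_gt0.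
case: (leqP r r') => _; have := p0 r; have := p0 r'; lra.
Qed.

Definition rspace_ent := entourage_ rball.

Definition nbhs_rspace q := nbhs_ rspace_ent q.

HB.instance Definition _ := hasNbhs.Build (rspace R k) nbhs_rspace.

HB.instance Definition _ := @Nbhs_isPseudoMetric.Build R (rspace R k)
  rspace_ent erefl rball rball_center rball_sym rball_triangle erefl.

End Metric.

Section Pointed.

Definition vert1 : {pred nat} := pred1 0%N.
Definition adj1 : rel nat := fun _ _ => false.
Lemma adj1_sym : symmetric adj1. Proof. by []. Qed.
Lemma adj1_irr : irreflexive adj1. Proof. by []. Qed.
Lemma adj1_vert u v : adj1 u v -> (u \in vert1) && (v \in vert1).
Proof. by []. Qed.

Definition graph1 : graph := Graph adj1_sym adj1_irr adj1_vert.

Lemma connected1 : graph_connected graph1.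
Proof.
move=> [u /[dup]/eqP -> ?] [v /[dup]/eqP -> ?]; exists 0%N.
by exists [::].
Qed.

Lemma finite1 : locally_finite graph1.
Proof. by move=> v; apply: (sub_finite_set _ (finite_set0 _)) => u. Qed.

Definition lgraph1 : lgraph := LGraph connected1 finite1.

Definition vertex1 : vertex lgraph1 := exist _ 0%N (eqxx 0%N).

HB.instance Definition _ R k := isPointed.Build (rspace R k)
  (class_of R (RGraph [tuple of nseq k vertex1])).

End Pointed.

Definition borel (T : ptopologicalType) : measurableType (@open T).-sigma :=
  g_sigma_algebraType (@open T).

Notation Gstar R := (rspace R 1).
Notation Gstarstar R := (rspace R 2).

(* [G, o] *)
Definition cls (R : realType) (G : lgraph) (o : vertex G) : Gstar R :=
  class_of R (RGraph [tuple o]).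

(* [G, o, v] *)
Definition cls2 (R : realType) (G : lgraph) (o v : vertex G) : Gstarstar R :=
  class_of R (RGraph [tuple o; v]).

Definition root1 (G : rgraph 1) : vertex G := tnth (roots G) ord0.

Lemma cls_root (R : realType) (q : Gstar R) : cls R (root1 (representative q)) = q.
Proof.
rewrite -[RHS]representativeK /cls; congr class_of.
case: (representative q) => G r /=; congr RGraph.
by apply: eq_from_tnth => i; rewrite (ord1 i) (tnth_nth (root1 (RGraph r))).
Qed.

(* F G o v stands for a quantity depending only on [G, o, v]; the sums are
   computed on a representative (G, o) of the class q, see sum_verticesE and
   sum_nbrsE. *)
Definition sum_vertices (R : realType)
    (F : forall G : lgraph, vertex G -> vertex G -> \bar R)
    (q : Gstar R) : \bar R :=
  let G := representative q in
  (\esum_(v in [set: vertex G]) F G (root1 G) v)%E.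

(* The neighbours are finitely many, by local finiteness. *)
Definition sum_nbrs (R : realType)
    (F : forall G : lgraph, vertex G -> vertex G -> R) (q : Gstar R) : R :=
  let G := representative q in \sum_(v \in nbrs (root1 G)) F G (root1 G) v.

Section WellDefined.
Variable R : realType.

Lemma cls_iso (G G' : lgraph) (o : vertex G) (o' : vertex G') :
  cls R o = cls R o' -> exists phi : vertex G -> vertex G',
  [/\ set_bij [set: vertex G] [set: vertex G'] phi,
      set_bij (nbrs o) (nbrs o') phi &
      forall v, cls2 R o v = cls2 R o' (phi v)].
Proof.
move=> /class_ofP[f [[/= fG finj fsurj] fadj [fo]]].
pose phi (v : vertex G) : vertex G' := Sub (f (val v)) (fG _ (valP v)).
have phi_inj u v : phi u = phi v -> u = v.
  move=> /(congr1 val)/= E; apply: val_inj; apply: finj => //.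
    by rewrite inE /=; exact: valP.
  by rewrite inE /=; exact: valP.
have phi_surj w : exists v, phi v = w.
  have [v vG vw] := fsurj _ (valP w).
  by exists (Sub v vG); exact: val_inj.
have phi_adj u v : adj G' (val (phi u)) (val (phi v)) = adj G (val u) (val v).
  by rewrite fadj ?(valP u) ?(valP v).
have phi_o : phi o = o' by exact: val_inj.
exists phi; split.
- by split => // [u v _ _ /phi_inj //|w _]; have [v] := phi_surj w; exists v.
- split => [v|u v _ _ /phi_inj //|w].
    by rewrite /nbrs /= -phi_o phi_adj.
  have [v <-] := phi_surj w.
  by rewrite /nbrs /= -phi_o phi_adj => ?; exists v.
- move=> v; apply/class_ofP; exists f; split => //.
  by rewrite /root_seq /= fo.
Qed.

Lemma sum_verticesE (F : forall G : lgraph, vertex G -> vertex G -> \bar R) :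
  (forall (G G' : lgraph) (o v : vertex G) (o' v' : vertex G'),
    cls2 R o v = cls2 R o' v' -> F G o v = F G' o' v') ->
  forall (G : lgraph) (o : vertex G),
  sum_vertices F (cls R o) = (\esum_(v in [set: vertex G]) F G o v)%E.
Proof.
move=> Finv G o; rewrite /sum_vertices.
have [phi [phiV _ phiE]] := cls_iso (esym (cls_root (cls R o))).
rewrite (reindex_esum _ _ _ _ phiV); apply: eq_esum => v _.
exact/esym/Finv/phiE.
Qed.

Lemma sum_nbrsE (F : forall G : lgraph, vertex G -> vertex G -> R) :
  (forall (G G' : lgraph) (o v : vertex G) (o' v' : vertex G'),
    cls2 R o v = cls2 R o' v' -> F G o v = F G' o' v') ->
  forall (G : lgraph) (o : vertex G),
  sum_nbrs F (cls R o) = \sum_(v \in nbrs o) F G o v.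
Proof.
move=> Finv G o; rewrite /sum_nbrs.
have [phi [_ phiN phiE]] := cls_iso (esym (cls_root (cls R o))).
rewrite (reindex_fsbig _ _ _ _ phiN); apply: eq_fsbigr => v _.
exact/esym/Finv/phiE.
Qed.

End WellDefined.

Section Measures.
Variables (R : realType) (mu : probability (borel (Gstar R)) R).
Local Open Scope ereal_scope.

Definition unimodular : Prop :=
  forall T : Gstarstar R -> \bar R,
  measurable_fun [set: borel (Gstarstar R)] T ->
  (forall z, 0 <= T z) ->
  \int[mu]_q sum_vertices (fun G o v => T (cls2 R o v)) q =
  \int[mu]_q sum_vertices (fun G o v => T (cls2 R v o)) q.

(* P G o for mu-a.e. [G, o], for every choice of the representative *)
Definition ae_rooted (P : forall G : lgraph, vertex G -> Prop) : Prop :=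
  {ae mu, forall q : Gstar R,
    forall (G : lgraph) (o : vertex G), cls R o = q -> P G o}.

Definition bounded_degree : Prop :=
  exists D : nat, ae_rooted (fun G o => forall v : vertex G, (nbrs v #<= `I_D)%card).

Definition square_integrable (H : completeNormedModType R)
    (x : Gstar R -> H) : Prop :=
  @measurable_fun _ _ (borel (Gstar R)) (borel H) setT x /\
  \int[mu]_q (`|x q| ^+ 2)%:E < +oo.

End Measures.

Section Gateaux.
Variable R : realType.

(* The norm of the Banach space H comes from the inner product dot. *)
Definition separable_hilbert (H : completeNormedModType R)
    (dot : {dot H for idfun}) : Prop :=
  (forall u, dot u u = `|u| ^+ 2) /\ exists2 S : set H, countable S & dense S.

Definition gateaux_differentiable (V : normedModType R) (F : V -> R) (a : V) :
    Prop :=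
  [/\ forall v, derivable F a v,
      scalar (fun v => 'D_v F a : R) &
      continuous (fun v => 'D_v F a : R)].

(* Riesz representative of the Gateaux derivative, 0 if there is none *)
Definition gradient (H : completeNormedModType R) (dot : {dot H for idfun})
    (F : H -> R) (a : H) : H :=
  xget 0 [set g | forall v, 'D_v F a = dot g v].

End Gateaux.

Section Potential.
Variables (R : realType) (H : completeNormedModType R).
Variables (dot : {dot H for idfun}) (mu : probability (borel (Gstar R)) R).
Variables (f : Gstar R -> H -> R) (h psi : Gstarstar R -> H -> H -> R).

Definition grad (g : Gstar R -> H -> R) q a : H := gradient dot (g q) a.

Definition grad1 (g : Gstarstar R -> H -> H -> R) z a b : H :=
  gradient dot (fun a' => g z a' b) a.

Definition grad2 (g : Gstarstar R -> H -> H -> R) z a b : H :=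
  gradient dot (fun b' => g z a b') b.

Record admissible : Prop := {
  admissible_measurable_f : measurable_fun setT
    (fun p : borel (Gstar R) * borel H => f p.1 p.2);
  admissible_measurable_h : measurable_fun setT
    (fun p : borel (Gstarstar R) * borel H * borel H => h p.1.1 p.1.2 p.2);
  admissible_measurable_psi : measurable_fun setT
    (fun p : borel (Gstarstar R) * borel H * borel H => psi p.1.1 p.1.2 p.2);
  admissible_diff_f : ae_rooted mu (fun G o =>
    forall a, gateaux_differentiable (f (cls R o)) a);
  admissible_diff_h_psi : ae_rooted mu (fun G o =>
    forall v, nbrs o v ->
    [/\ forall a b, gateaux_differentiable (fun a' => h (cls2 R o v) a' b) a,
        forall p : H * H,
          gateaux_differentiable (fun p' : H * H => psi (cls2 R o v) p'.1 p'.2) p &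
        forall a b, grad1 psi (cls2 R o v) a b = grad1 h (cls2 R o v) a b /\
                    grad2 psi (cls2 R o v) a b = grad1 h (cls2 R v o) b a]);
  admissible_lipschitz : exists Lf Lh : R, [/\ 0 <= Lf, 0 <= Lh &
    ae_rooted mu (fun G o =>
      (forall a a', `|grad f (cls R o) a - grad f (cls R o) a'| <=
                    Lf * `|a - a'|) /\
      (forall v, nbrs o v -> forall a a' b b',
        `|grad1 h (cls2 R o v) a b - grad1 h (cls2 R o v) a' b'| <=
        Lh * (`|a - a'| + `|b - b'|)))];
  admissible_integrable : exists a : H,
    [/\ (\int[mu]_q (`|f q a|)%:E < +oo)%E,
        (\int[mu]_q (`|grad f q a| ^+ 2)%:E < +oo)%E,
        (\int[mu]_q (sum_nbrs (fun G o v => `|psi (cls2 R o v) a a|) q)%:E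
          < +oo)%E &
        (\int[mu]_q (sum_nbrs (fun G o v => `|grad1 h (cls2 R o v) a a| ^+ 2)
          q)%:E < +oo)%E] }.

Definition potential_integrand (x : Gstar R -> H) (q : Gstar R) : R :=
  f q (x q) +
  2^-1 * sum_nbrs (fun G o v => psi (cls2 R o v) (x (cls R o)) (x (cls R v))) q.

Definition potential (x : Gstar R -> H) : \bar R :=
  (\int[mu]_q (potential_integrand x q)%:E)%E.

End Potential.

(* Main.v *)
Require Import Defs.
From HB Require Import structures.
From mathcomp Require Import all_boot all_order all_algebra.
From mathcomp Require Import all_classical all_reals all_analysis.
From mathcomp Require Import measurable_realfun lra.
Import Order.TTheory GRing.Theory Num.Theory.
Import numFieldNormedType.Exports.
(* Imported again because fingraph also defines [rgraph] and [roots]. *)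
Import Defs.

(**
  Fix a as in (iv) and put p = |x([G,o]) - a|.  By the mean value theorem and
  the Lipschitz bounds,
    |f(x o) - f(a)| <= p (|grad f(a)| + Lf p),
  and the increment psi(x o, x v) - psi(a, a) splits into
    psi(x o, x v) - psi(a, x v), controlled by grad1 h([G,o,v]), and
    psi(a, x v) - psi(a, a), controlled by grad1 h([G,v,o]).
  Only grad1 h([G,o,v]) at (a, a) is known to be square integrable, so the
  second increment is first moved by mass transport to the other endpoint of
  the edge, where its gradient is grad1 h([G,o,v]).  Mass transport and the
  degree bound also give the integrability of the sum of |x([G,v]) - a|^2 over
  v ~ o.

  A sum over the neighbours of o of a measurable function of [G,o,v] is
  measurable: it is the integral against the counting measure of the [G,o,v],
  v ~ o, and for U open the number of v ~ o with [G,o,v] in U is lower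
  semicontinuous, since the (r+1)-ball around o determines the r-balls around
  the pairs (o, v); the pi-lambda theorem extends this to Borel U.

  The gradients are not known to be measurable.  The bounds have the form
  F <= u + g with F, u measurable and g a sum of squared norms of gradients;
  then max(0, F - u) <= g, and monotonicity of the (lower) integral is enough.
*)

Set Implicit Arguments.
Unset Strict Implicit.
Unset Printing Implicit Defensive.

Local Open Scope classical_set_scope.
Local Open Scope ring_scope.

(** * Riesz representation and increments of Gateaux differentiable functions *)

Section Hilbert.
Context {R : realType} {H : completeNormedModType R}.
Variable dot : {dot H for idfun}.
Hypothesis hH : separable_hilbert dot.

Lemma dotC u v : dot u v = dot v u.
Proof. by rewrite (hermC dot) expr0 mul1r. Qed.

Lemma dot_norm u : dot u u = `|u| ^+ 2.
Proof. by have [-> _] := hH. Qed.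

Lemma normD_dot u v : `|u + v| ^+ 2 = `|u| ^+ 2 + 2 * dot u v + `|v| ^+ 2.
Proof.
rewrite -!dot_norm linearDl !linearDr /= [dot v u]dotC; lra.
Qed.

Lemma dotZr u (t : R) v : dot u (t *: v) = t * dot u v.
Proof. by rewrite linearZr_LR. Qed.

Lemma dot_cauchy_schwarz u v : `|dot u v| <= `|u| * `|v|.
Proof.
have [->|v0] := eqVneq v 0; first by rewrite linear0r normr0 normr0 mulr0.
have nv : 0 < `|v| by rewrite normr_gt0.
have H0 t : 0 <= `|u| ^+ 2 + 2 * (t * dot u v) + (t * `|v|) ^+ 2.
  have := normD_dot u (t *: v); rewrite dotZr normrZ.
  have -> : (`|t| * `|v|) ^+ 2 = (t * `|v|) ^+ 2 by rewrite !exprMn real_normK // num_real.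
  move=> <-; exact: sqr_ge0.
rewrite -(ler_pXn2r (n := 2)) ?nnegrE ?mulr_ge0 //.
rewrite real_normK ?num_real // exprMn.
have nv2 : 0 < `|v| ^+ 2 by rewrite exprn_gt0.
(* This [t] minimises |u + t v|^2; multiplying the quadratic by |v|^2 clears its denominator. *)
set t := - dot u v / `|v| ^+ 2.
have tv : t * `|v| ^+ 2 = - dot u v by rewrite mulfVK // gt_eqF.
have : 0 <= (`|u| ^+ 2 + 2 * (t * dot u v) + (t * `|v|) ^+ 2) * `|v| ^+ 2.
  by rewrite mulr_ge0 // ltW.
have -> : (`|u| ^+ 2 + 2 * (t * dot u v) + (t * `|v|) ^+ 2) * `|v| ^+ 2 =
  `|u| ^+ 2 * `|v| ^+ 2 + 2 * (t * `|v| ^+ 2 * dot u v) + (t * `|v| ^+ 2) ^+ 2 by lra.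
rewrite tv; lra.
Qed.

(* l is represented by the minimiser of J(u) = |u|^2 - 2 l(u): the parallelogram
   identity makes minimising sequences Cauchy. *)
Lemma riesz (l : H -> R) : scalar l -> continuous l ->
  exists g, forall v, l v = dot g v.
Proof.
move=> lin cl.
have l0 : l 0 = 0 by have := lin (-1) 0 0; rewrite scaler0 addr0 mulN1r addNr.
have lD u v : l (u + v) = l u + l v by rewrite -{1}[u]scale1r lin mul1r.
have lZ t u : l (t *: u) = t * l u by rewrite -[t *: u]addr0 lin l0 addr0.
(* Continuity at 0 gives a radius [e] within which |l| < 1; rescaling [u] to norm e/2 yields the
   constant 2/e. *)
have [C [C0 lC]] : exists C : R, 0 <= C /\ forall u, `|l u| <= C * `|u|.
  have /cvgrPdist_lt /(_ 1 ltr01) := cl 0.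
  rewrite l0 => /nbhs_normP[e /= e0 He].
  exists (2 / e); split=> [|u]; first by rewrite divr_ge0 // ltW.
  have [->|u0] := eqVneq u 0; first by rewrite l0 !normr0 mulr0.
  have nu : 0 < `|u| by rewrite normr_gt0.
  have /He : ball_ Num.norm 0 e ((e / 2 / `|u|) *: u).
    rewrite /= sub0r normrN normrZ ger0_norm ?divr_ge0 ?ltW //.
    by rewrite mulfVK ?gt_eqF //; lra.
  have k0 : 0 < e / 2 / `|u| by rewrite !divr_gt0.
  rewrite /= sub0r normrN lZ normrM gtr0_norm // => He1; apply: ltW.
  rewrite -(ltr_pM2l k0); apply: lt_le_trans He1 _.
  by rewrite [2 / e * _]mulrC mulrA mulfVK ?gt_eqF // mulrA mulfVK ?divff ?gt_eqF.
pose J u := `|u| ^+ 2 - 2 * l u.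
have Jlb u : - C ^+ 2 <= J u.
  rewrite /J; have := lC u; rewrite ler_norml => /andP[_ lu].
  have := sqr_ge0 (`|u| - C); nra.
have infJ : has_inf (range J).
  split; first by exists (J 0); exists 0.
  by exists (- C ^+ 2) => _ [u _ <-].
pose m := inf (range J).
have mJ u : m <= J u by apply: ge_inf; [exact: infJ.2|exists u].
(* By the parallelogram identity the left side equals 2 (J u + J w) - 4 J((u + w)/2), and J is at
   least [m] at the midpoint. *)
have Jpar u w : `|u - w| ^+ 2 <= 2 * (J u + J w - 2 * m).
  have := mJ (2^-1 *: (u + w)); rewrite /J lZ lD normrZ ger0_norm ?invr_ge0 //.
  have h1 := normD_dot u w; have h2 := normD_dot u (- w).
  rewrite linearNr /= normrN in h2.
  rewrite exprMn => h3.
  lra.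
have /choice[u_ Hu] : forall n : nat, exists u, J u < m + n.+1%:R^-1.
  move=> n; have /(inf_adherent)/(_ infJ)[_ [u _ <-] ?] : 0 < n.+1%:R^-1 :> R.
    by rewrite invr_gt0.
  by exists u.
have near_u (e : R) : 0 < e -> exists N : nat,
    forall i j : nat, (N <= i)%N -> (N <= j)%N -> `|u_ i - u_ j| < e.
  (* With both excesses over [m] below e^2/4, the bound [Jpar] is below 2 (e^2/4 + e^2/4) = e^2. *)
  move=> e0; have e8 : 0 < e ^+ 2 / 4 by rewrite divr_gt0 // exprn_gt0.
  have [N _ HN] : \forall n \near \oo, (n.+1%:R^-1 : R) < e ^+ 2 / 4.
    exact: near_infty_natSinv_lt (PosNum e8).
  exists N => i j Ni Nj; rewrite -(ltr_pXn2r (n := 2)) ?nnegrE ?(ltW e0) //.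
  apply: le_lt_trans (Jpar _ _) _.
  have := Hu i; have := Hu j; have := HN _ Ni; have := HN _ Nj => /=.
  move: (e ^+ 2) (i.+1%:R^-1) (j.+1%:R^-1) (J _) (J _) => a b c d f; lra.
have cu : cauchy (u_ @ \oo).
  apply/cauchy_ballP => e /near_u[N HN].
  rewrite near_map2; exists ([set n | (N <= n)%N], [set n | (N <= n)%N]).
    by split; exists N.
  by move=> [i j] /= [Ni Nj]; rewrite -ball_normE /=; exact: HN.
have /cauchy_cvg/cvg_ex[g ug] := cu.
have Jg : J g <= m.
  have Jc : J (u_ n) @[n --> \oo] --> J g.
    apply: cvgB; last by apply: cvgM; [exact: cvg_cst|exact: (cvg_comp _ _ ug (cl _))].
    rewrite expr2; under eq_fun do rewrite expr2.
    by apply: cvgM; exact: cvg_norm.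
  have Je (e : R) : 0 < e -> J g <= m + e.
    move=> e0; apply: (closed_cvg [set x | x <= m + e]) Jc; first exact: closed_le.
    have [N _ HN] : \forall n \near \oo, (n.+1%:R^-1 : R) < e.
      exact: near_infty_natSinv_lt (PosNum e0).
    exists N => // n /= Nn; apply/ltW/(lt_trans (Hu n)).
    by rewrite ltrD2l; exact: HN.
  by apply/ler_addgt0Pr => e; exact: Je.
exists g => v; set c := dot g v - l v.
suff : c = 0 by rewrite /c; lra.
have Hc t : 0 <= t ^+ 2 * `|v| ^+ 2 + 2 * t * c.
  have := le_trans Jg (mJ (g + t *: v)).
  rewrite /J normD_dot dotZr normrZ lD lZ exprMn real_normK ?num_real // /c; lra.
set n := `|v| ^+ 2 in Hc; have n0 : 0 <= n by exact: sqr_ge0.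
(* The denominator n + 1 instead of n includes the case v = 0. With c = - s (n + 1) the quadratic
   becomes - s^2 (n + 2), which forces s = 0. *)
have := Hc (- c / (n + 1)); set s := - c / (n + 1).
have sE : c = - (s * (n + 1)) by rewrite mulfVK ?opprK // gt_eqF // ltr_wpDl.
move=> Hs; have : s ^+ 2 * (n + 2) <= 0.
  have -> : s ^+ 2 * (n + 2) = - (s ^+ 2 * n + 2 * s * c) by rewrite sE; lra.
  by rewrite oppr_le0.
rewrite pmulr_lle0 ?ltr_wpDl // => s0.
have /eqP : s ^+ 2 = 0 by apply/eqP; rewrite eq_le s0 sqr_ge0.
by rewrite sqrf_eq0 => /eqP s00; rewrite sE s00 mul0r oppr0.
Qed.

(** Riesz supplies a representative, so [xget] in [gradient] does not fall back on its default 0. *)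
Lemma gradientP (F : H -> R) a : gateaux_differentiable F a ->
  forall v, 'D_v F a = dot (gradient dot F a) v.
Proof.
move=> [_ lF /(riesz lF)[g gP]].
exact: (@xgetPex _ 0 [set g | forall v, 'D_v F a = dot g v] (ex_intro _ g gP)).
Qed.

Lemma is_derive_line (F : H -> R) (a w : H) (t : R) :
  derivable F (a + t *: w) w ->
  is_derive t 1 (fun s : R => F (a + s *: w)) ('D_w F (a + t *: w)).
Proof.
move=> dF; have E : (fun h : R => h^-1 *: (((fun s => F (a + s *: w)) \o shift t) (h *: 1)
    - F (a + t *: w))) =
  (fun h : R => h^-1 *: ((F \o shift (a + t *: w)) (h *: w) - F (a + t *: w))).
  apply/funext => h /=; congr (_ *: (F _ - _)).
  by rewrite scalerDl addrCA [h *: 1]mulr1.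
by split; rewrite /derivable /derive E.
Qed.

(** Mean value theorem on the segment from [a] to [b]: at the intermediate point a + t (b - a) the
    gradient differs from the one at [a] by at most L t |b - a| with t <= 1, and Cauchy-Schwarz
    concludes. *)
Lemma gradient_lipschitz_bound (F : H -> R) (L : R) (a b : H) : 0 <= L ->
  (forall c, gateaux_differentiable F c) ->
  (forall c, `|gradient dot F c - gradient dot F a| <= L * `|c - a|) ->
  `|F b - F a| <= `|b - a| * (`|gradient dot F a| + L * `|b - a|).
Proof.
move=> L0 dF lipF; pose w := b - a.
have dphi (t : R) : is_derive t 1 (fun s : R => F (a + s *: w)) ('D_w F (a + t *: w)).
  by apply: is_derive_line; have [] := dF (a + t *: w).
have cphi : {within `[0, 1 : R], continuous (fun s : R => F (a + s *: w))}.
  apply: derivable_within_continuous => t _.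
  exact: (@ex_derive _ _ _ _ _ _ _ (dphi t)).
have [t] := MVT_segment (ler01) (fun t _ => dphi t) cphi.
rewrite in_itv /= => /andP[t0 t1].
rewrite scale1r scale0r addr0 subr0 mulr1 /w subrKC -/w => ->.
rewrite gradientP //; apply: le_trans (dot_cauchy_schwarz _ _) _.
rewrite mulrC ler_wpM2l //.
set g := gradient dot F a; set g' := gradient dot F _.
have := lipF (a + t *: w); rewrite -/g -/g' addrAC subrr add0r normrZ ger0_norm // => h.
rewrite -(subrK g g'); apply: le_trans (ler_normD _ _) _.
rewrite addrC lerD2l; apply: le_trans h _; rewrite ler_wpM2l //.
by rewrite ler_piMl.
Qed.

End Hilbert.

(** * Partial Gateaux derivatives on a product *)

Section Partial.
Context {R : realType} {H : completeNormedModType R}.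

(** The partial derivative along [v] is the joint derivative along (v, 0), so linearity and
    continuity are inherited through v |-> (v, 0). *)
Lemma gateaux_partial1 (F : H * H -> R) a b :
  gateaux_differentiable F (a, b) ->
  gateaux_differentiable (fun a' => F (a', b)) a.
Proof.
move=> [dF lF cF].
have E v : (fun h : R => h^-1 *: (((fun a' => F (a', b)) \o shift a) (h *: v) - F (a, b))) =
  (fun h : R => h^-1 *: ((F \o shift (a, b)) (h *: (v, 0)) - F (a, b))).
  apply/funext => h /=; congr (_ *: (F _ - _)).
  by congr pair; rewrite /= scaler0 add0r.
have D v : 'D_v (fun a' => F (a', b)) a = 'D_(v, 0) F (a, b) by rewrite /derive E.
split.
- by move=> v; rewrite /derivable E; exact: dF.
- move=> k u v /=; rewrite !D -lF /=; congr ('D_ _ _ _).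
  by congr pair; rewrite /= scaler0 add0r.
- rewrite (_ : (fun v => _) = (fun v => 'D_v F (a, b)) \o (fun v => (v, 0))); last first.
    by apply/funext => v; exact: D.
  move=> v; apply: continuous_comp; last exact: cF.
  by apply: cvg_pair => //=; exact: cvg_cst.
Qed.

Lemma gateaux_partial2 (F : H * H -> R) a b :
  gateaux_differentiable F (a, b) ->
  gateaux_differentiable (fun b' => F (a, b')) b.
Proof.
move=> [dF lF cF].
have E v : (fun h : R => h^-1 *: (((fun b' => F (a, b')) \o shift b) (h *: v) - F (a, b))) =
  (fun h : R => h^-1 *: ((F \o shift (a, b)) (h *: (0, v)) - F (a, b))).
  apply/funext => h /=; congr (_ *: (F _ - _)).
  by congr pair; rewrite /= scaler0 add0r.
have D v : 'D_v (fun b' => F (a, b')) b = 'D_(0, v) F (a, b) by rewrite /derive E.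
split.
- by move=> v; rewrite /derivable E; exact: dF.
- move=> k u v /=; rewrite !D -lF /=; congr ('D_ _ _ _).
  by congr pair; rewrite /= scaler0 add0r.
- rewrite (_ : (fun v => _) = (fun v => 'D_v F (a, b)) \o (fun v => (0, v))); last first.
    by apply/funext => v; exact: D.
  move=> v; apply: continuous_comp; last exact: cF.
  by apply: cvg_pair => //=; exact: cvg_cst.
Qed.
End Partial.

(** * Balls and isomorphisms *)

(** Covers whole graphs and balls alike, so that a single restriction lemma serves isomorphisms of
    graphs and of balls. *)
Definition induced_subgraph (A G : graph) :=
  {subset vert A <= vert G} /\ {in vert A &, forall u v, adj A u v = adj G u v}.

Lemma induced_refl G : induced_subgraph G G. Proof. by split=> [v|u v]. Qed.

Lemma induced_ball G s r : induced_subgraph (ball_graph G s r) G.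
Proof.
by split=> [v /vert_ballP[]|u v uB vB] //; exact: adj_ballE.
Qed.

(** A path of length at most [r] starting in [t] stays in the ball, hence in [A], where [f]
    preserves adjacency; its image is a path of the same length in [G']. *)
Lemma iso_ball_sub f A s A' s' G G' t r :
  induced_subgraph A G -> induced_subgraph A' G' ->
  is_root_iso f A s A' s' ->
  {subset vert (ball_graph G t r) <= vert A} -> {subset t <= vert A} ->
  {in vert (ball_graph G t r), forall v, f v \in vert (ball_graph G' (map f t) r)}.
Proof.
move=> [AG adjA] [AG' adjA'] [[/= fA _ _] fadj _] BA tA v vB.
have := vB => /vert_ballP[_ [ o ot [p [pp pl pr]]]].
have pA : {subset o :: p <= vert A}.
  move=> u; rewrite inE => /orP[/eqP-> |up]; first exact: tA.
  apply: BA; apply/vert_ballP; split.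
    exact: path_vert (AG _ (tA _ ot)) pp _ up.
  by exists o => //; exact: dist_le_path pp pr _ up.
apply/vert_ballP; split; first exact/AG'/fA/BA.
exists (f o); first exact: map_f.
exists (map f p); split; last by rewrite size_map.
  elim: p o {ot pl pr} pp pA => [//|u p IH] o /= /andP[ou pp] pA.
  have oA : o \in vert A by apply: pA; rewrite mem_head.
  have uA : u \in vert A by apply: pA; rewrite inE mem_head orbT.
  rewrite IH //; last by move=> w wp; apply: pA; rewrite inE wp orbT.
  by rewrite -adjA' ?fadj ?adjA ?ou //; exact: fA.
by rewrite last_map pl.
Qed.

Lemma iso_ball_restrict f A s A' s' G G' t r :
  induced_subgraph A G -> induced_subgraph A' G' ->
  {subset s <= vert A} -> is_root_iso f A s A' s' -> {subset t <= vert A} ->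
  {subset vert (ball_graph G t r) <= vert A} ->
  {subset vert (ball_graph G' (map f t) r) <= vert A'} ->
  root_iso (ball_graph G t r) t (ball_graph G' (map f t) r) (map f t).
Proof.
move=> iA iA' sA fi tA BA BA'; exists f.
have [g gi fgK] := is_root_iso_inv sA fi.
have fB := iso_ball_sub iA iA' fi BA tA.
have tA' : {subset map f t <= vert A'}.
  by move=> _ /mapP[v /tA vA ->]; have [[fA _ _] _ _] := fi; exact: fA.
have gB := iso_ball_sub iA' iA gi BA' tA'.
have gft : map g (map f t) = t.
  by rewrite -map_comp -[RHS]map_id; apply/eq_in_map => u /tA /fgK.
rewrite gft in gB.
case: (fi) => -[fA finj fsurj] fadj fs; split => //.
- split => /=.
  + exact: fB.
  + by move=> u v; rewrite !inE /= => /BA uA /BA vA; apply: finj; rewrite inE.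
  + move=> w wB; exists (g w); first exact: gB.
    by have [u uA <-] := fsurj _ (BA' _ wB); rewrite fgK.
- move=> u v uB vB; rewrite !adj_ballE ?fB //.
  have [_ adjA] := iA; have [_ adjA'] := iA'.
  have uA := BA _ uB; have vA := BA _ vB.
  by rewrite -adjA // -adjA' ?fadj //; exact: fA.
Qed.

Lemma vert_ball_sub G s t r : {subset t <= s} ->
  {subset vert (ball_graph G t r) <= vert (ball_graph G s r)}.
Proof.
move=> ts v /vert_ballP[vG [ o ot ov]]; apply/vert_ballP; split => //.
by exists o => //; exact: ts.
Qed.

Lemma vert_ball_adj G o v r : adj G o v ->
  {subset vert (ball_graph G [:: o; v] r) <= vert (ball_graph G [:: o] r.+1)}.
Proof.
move=> ov w /vert_ballP[wG [u]]; rewrite !inE => /orP[]/eqP-> [p [pp pl pr]];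
  apply/vert_ballP; split => //; exists o; rewrite ?inE //.
  by exists p; split => //; exact: leqW.
by exists (v :: p); rewrite /= ov.
Qed.

Lemma rgraph_iso_ball (k r : nat) (G G' : rgraph k) : rgraph_iso G G' -> ball_iso r G G'.
Proof.
move=> [f fi]; have [_ _ fs] := fi; rewrite /ball_iso -fs.
apply: iso_ball_restrict fi _ _ _; try exact: induced_refl; try exact: root_seq_vert.
- by move=> v /vert_ballP[].
- by move=> v /vert_ballP[].
Qed.

(** * The topology in terms of isomorphic balls *)

Section Topology.
Variable R : realType.

(** The metric is computed on chosen representatives; this frees it from the choice, since
    isomorphic rooted graphs have isomorphic balls of every radius. *)
Lemma ball_iso_class (k r : nat) (G G' : rgraph k) :
  ball_iso r (representative (class_of R G)) (representative (class_of R G')) <->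
  ball_iso r G G'.
Proof.
have E (K : rgraph k) : ball_iso r (representative (class_of R K)) K.
  by apply/rgraph_iso_ball/(class_ofP R); exact: representativeK.
split=> i; first exact: ball_iso_trans (ball_iso_sym (E _)) (ball_iso_trans i (E _)).
exact: ball_iso_trans (E _) (ball_iso_trans i (ball_iso_sym (E _))).
Qed.

Lemma nbhs_rspaceP k (q : rspace R k) (U : set (rspace R k)) :
  nbhs q U <->
  exists r, forall q', ball_iso r (representative q) (representative q') -> U q'.
Proof.
split=> [/nbhs_ballP[e /= e0 eU]|[r rU]].
  have [r re] := filter_ex (near_infty_natSinv_expn_lt (PosNum e0)).
  exists r => q' i; apply: eU; apply/rballP; exists r => //.
  by rewrite div1r in re.
apply/nbhs_ballP; exists (2 ^- r) => /=; first by rewrite invr_gt0 exprn_gt0.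
move=> q' /rballP[r' i rr]; apply: rU; apply: ball_iso_le i.
move: rr; rewrite ltf_pV2 ?posrE ?exprn_gt0 // ltr_eXn2l ?ltr1n //.
exact: ltnW.
Qed.

Lemma open_rspaceP k (U : set (rspace R k)) :
  open U <-> forall q, U q ->
  exists r, forall q', ball_iso r (representative q) (representative q') -> U q'.
Proof.
rewrite openE; split=> [UU q /UU /nbhs_rspaceP //|UU q /UU rU].
exact/nbhs_rspaceP.
Qed.

End Topology.

(** * Projections and swap of doubly rooted graphs, and their continuity *)

Section DoublyRooted.
Variable R : realType.
Implicit Type z : Gstarstar R.

Definition rep1 z : vertex (representative z) := tnth (roots (representative z)) ord0.
Definition rep2 z : vertex (representative z) := tnth (roots (representative z)) ord_max.

Definition class1 z : Gstar R := cls R (rep1 z).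
Definition class2 z : Gstar R := cls R (rep2 z).
Definition swap_roots z : Gstarstar R := cls2 R (rep2 z) (rep1 z).
Definition root_edges : set (Gstarstar R) :=
  [set z | adj (representative z) (val (rep1 z)) (val (rep2 z))].

Lemma rep_rootsE z : roots (representative z) = [tuple rep1 z; rep2 z].
Proof.
apply: eq_from_tnth => i; rewrite [RHS](tnth_nth (rep1 z)).
case: (unliftP ord0 i) => [j ->|->] //=.
by rewrite /rep2 (ord1 j); congr tnth; exact: val_inj.
Qed.

Lemma cls2_rep z : cls2 R (rep1 z) (rep2 z) = z.
Proof.
rewrite -[RHS]representativeK /cls2 -rep_rootsE.
by case: (representative z).
Qed.

(** The root list is emptied and the root conditions stated apart, so that the same map can be
    reused with one root, or with both in either order. *)
Lemma cls2_isoP (G G' : lgraph) (o v : vertex G) (o' v' : vertex G') :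
  cls2 R o v = cls2 R o' v' -> exists2 f : nat -> nat,
    is_root_iso f G [::] G' [::] & f (val o) = val o' /\ f (val v) = val v'.
Proof. by move=> /class_ofP[f [fb fadj [fo fv]]]; exists f. Qed.

Lemma cls2_iso (G G' : lgraph) (o v : vertex G) (o' v' : vertex G') f :
  is_root_iso f G [::] G' [::] -> f (val o) = val o' -> f (val v) = val v' ->
  [/\ cls2 R o v = cls2 R o' v', cls2 R v o = cls2 R v' o',
      cls R o = cls R o', cls R v = cls R v' &
      adj G (val o) (val v) = adj G' (val o') (val v')].
Proof.
move=> [fb fadj _] fo fv; split.
- by apply/class_ofP; exists f; split => //; rewrite /root_seq /= fo fv.
- by apply/class_ofP; exists f; split => //; rewrite /root_seq /= fo fv.
- by apply/class_ofP; exists f; split => //; rewrite /root_seq /= fo.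
- by apply/class_ofP; exists f; split => //; rewrite /root_seq /= fv.
- by rewrite -fo -fv fadj ?(valP o) ?(valP v).
Qed.

Lemma cls2E (G : lgraph) (o v : vertex G) :
  [/\ class1 (cls2 R o v) = cls R o, class2 (cls2 R o v) = cls R v,
      swap_roots (cls2 R o v) = cls2 R v o & root_edges (cls2 R o v) <-> nbrs o v].
Proof.
have [f fi [fo fv]] := cls2_isoP (cls2_rep (cls2 R o v)).
by have [_ E2 E3 E4 E5] := cls2_iso fi fo fv; split; rewrite // /nbrs /= -E5.
Qed.

Lemma class1E (G : lgraph) (o v : vertex G) : class1 (cls2 R o v) = cls R o.
Proof. by have [] := cls2E o v. Qed.

Lemma class2E (G : lgraph) (o v : vertex G) : class2 (cls2 R o v) = cls R v.
Proof. by have [] := cls2E o v. Qed.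

Lemma swap_rootsE (G : lgraph) (o v : vertex G) : swap_roots (cls2 R o v) = cls2 R v o.
Proof. by have [] := cls2E o v. Qed.

Lemma root_edgesE (G : lgraph) (o v : vertex G) : root_edges (cls2 R o v) <-> nbrs o v.
Proof. by have [] := cls2E o v. Qed.

Lemma nbrs_sym (G : lgraph) (o v : vertex G) : nbrs o v <-> nbrs v o.
Proof. by rewrite /nbrs /= adj_sym. Qed.

Lemma ball_iso_cls (G G' : lgraph) (o : vertex G) (o' : vertex G') r :
  root_iso (ball_graph G [:: val o] r) [:: val o]
           (ball_graph G' [:: val o'] r) [:: val o'] ->
  ball_iso r (representative (cls R o)) (representative (cls R o')).
Proof. by move=> i; apply/ball_iso_class. Qed.

Lemma ball_iso_rep_seq z z' (r : nat) :
  ball_iso r (representative z) (representative z') ->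
  root_iso (ball_graph (representative z) [:: val (rep1 z); val (rep2 z)] r)
      [:: val (rep1 z); val (rep2 z)]
    (ball_graph (representative z') [:: val (rep1 z'); val (rep2 z')] r)
      [:: val (rep1 z'); val (rep2 z')].
Proof. by rewrite /ball_iso /root_seq !rep_rootsE. Qed.

(** The r-ball around both roots contains the r-ball around each of them and ignores their order. As
    an induced subgraph containing both roots, it also shows whether they are adjacent. *)
Lemma ball_iso_proj z z' (r : nat) :
  ball_iso r (representative z) (representative z') ->
  [/\ ball_iso r (representative (class1 z)) (representative (class1 z')),
      ball_iso r (representative (class2 z)) (representative (class2 z')),
      ball_iso r (representative (swap_roots z)) (representative (swap_roots z')) &
      root_edges z <-> root_edges z'].
Proof.
move=> /ball_iso_rep_seq; set G := lgraph_graph _; set G' := lgraph_graph _.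
set s := [:: _; _]; set s' := [:: _; _] => -[f fi].
have sG : {subset s <= vert G}.
  by move=> u; rewrite !inE => /orP[]/eqP->; exact: valP.
have sB := ball_root r sG; have [fb fadj [fo fv]] := fi.
have restrict t : {subset t <= s} -> {subset map f t <= s'} ->
    root_iso (ball_graph G t r) t (ball_graph G' (map f t) r) (map f t).
  move=> ts ts'; apply: iso_ball_restrict fi _ _ _ => //; try exact: induced_ball.
  - by move=> u /ts /sB.
  - exact: vert_ball_sub.
  - exact: vert_ball_sub.
split.
- have := restrict [:: val (rep1 z)]; rewrite /= fo => h.
  by apply/ball_iso_cls/h => u; rewrite !inE => /eqP->; rewrite eqxx.
- have := restrict [:: val (rep2 z)]; rewrite /= fv => h.
  by apply/ball_iso_cls/h => u; rewrite !inE => /eqP->; rewrite eqxx orbT.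
- have := restrict [:: val (rep2 z); val (rep1 z)]; rewrite /= fo fv => h.
  by apply/ball_iso_class/h => u; rewrite !inE orbC.
- have oB : val (rep1 z) \in vert (ball_graph G s r) by apply: sB; rewrite mem_head.
  have vB : val (rep2 z) \in vert (ball_graph G s r).
    by apply: sB; rewrite !inE eqxx orbT.
  have [fB _ _] := fb; have /= foB := fB _ oB; have /= fvB := fB _ vB.
  have := fadj _ _ oB vB; rewrite (adj_ballE oB vB) (adj_ballE foB fvB) fo fv.
  by rewrite /root_edges /= -/G -/G' => ->.
Qed.

Lemma root_maps_continuous : [/\ continuous class1, continuous class2, continuous swap_roots &
  open root_edges].
Proof.
split.
- move=> z U /nbhs_rspaceP[r rU]; apply/nbhs_rspaceP; exists r => z' /ball_iso_proj[h _ _ _].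
  exact: rU.
- move=> z U /nbhs_rspaceP[r rU]; apply/nbhs_rspaceP; exists r => z' /ball_iso_proj[_ h _ _].
  exact: rU.
- move=> z U /nbhs_rspaceP[r rU]; apply/nbhs_rspaceP; exists r => z' /ball_iso_proj[_ _ h _].
  exact: rU.
(* Radius 0 is enough: the 0-ball already contains both roots and the possible edge between them. *)
- apply/open_rspaceP => z za; exists 0%N => z' /ball_iso_proj[_ _ _ h].
  exact/h.
Qed.

End DoublyRooted.

(** * Borel measurability of continuous and semicontinuous maps *)

Section Borel.

Lemma borel_open (T : ptopologicalType) (U : set T) :
  open U -> measurable (U : set (borel T)).
Proof. by move=> oU; apply: sub_sigma_algebra. Qed.

Lemma continuous_borel (T U : ptopologicalType) (f : T -> U) :
  continuous f -> @measurable_fun _ _ (borel T) (borel U) setT f.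
Proof.
move=> /continuousP cf.
apply: (@measurability _ _ (borel T) (borel U) setT f (@open U) (erefl _)).
move=> _ [B oB <-].

rewrite setTI; apply: borel_open.
exact: cf.
Qed.

Lemma continuous_borel_real (T : ptopologicalType) (R : realType) (f : T -> R) :
  continuous f -> @measurable_fun _ _ (borel T) R setT f.
Proof.
move=> /continuousP cf; apply: (measurability _ (RGenOpens.measurableE R)).
move=> _ [_ [a [b ->] <-]].
rewrite setTI; apply: borel_open.
exact/cf/interval_open.
Qed.

Lemma lower_semicontinuous_borel (T : ptopologicalType) (R : realType) (f : T -> \bar R) :
  (forall a : R, open [set x | (a%:E < f x)%E]) ->
  @measurable_fun _ _ (borel T) (\bar R) setT f.
Proof.
move=> of_; apply: (@measurability _ _ (borel T) (\bar R) setT f _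
  (ErealGenOInfty.measurableE R)).
move=> /= _ [_ [a ->]] <-; rewrite setTI preimage_itvoy.
by apply: borel_open; exact: of_.
Qed.

End Borel.

(** * Measurability of sums over the neighbours of the root *)

Section NeighbourSum.
Variable R : realType.
Local Open Scope ereal_scope.

Definition nbr_esum (T : Gstarstar R -> \bar R) (q : Gstar R) : \bar R :=
  let G := representative q in \esum_(v in nbrs (root1 G)) T (cls2 R (root1 G) v).

Lemma nbr_esumE T (G : lgraph) (o : vertex G) :
  nbr_esum T (cls R o) = \esum_(v in nbrs o) T (cls2 R o v).
Proof.
rewrite /nbr_esum; have [phi [_ phiN phiE]] := cls_iso (esym (cls_root (cls R o))).
by rewrite (reindex_esum _ _ _ _ phiN); apply: eq_esum => v _; rewrite phiE.
Qed.

(** A list and not a set of classes: distinct neighbours may yield the same class [G,o,v] and must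
    be counted separately. *)
Definition nbr_seq (q : Gstar R) : seq (Gstarstar R) :=
  let G := representative q in
  [seq cls2 R (root1 G) v | v <- finmap.enum_fset (fset_set (nbrs (root1 G)))].

Lemma nbr_esum_seq T q : (forall z, 0 <= T z) ->
  nbr_esum T q = \sum_(z <- nbr_seq q) T z.
Proof.
move=> T0; have fN := @lgraph_finite (representative q) (root1 (representative q)).
by rewrite /nbr_esum esum_fset // fsbig_finite // big_map.
Qed.

(** The counting measure of [nbr_seq q] as a finite sum of Dirac masses; the default [point] of
    [nth] is never reached. *)
Definition nbr_measure (q : Gstar R) : {measure set (borel (Gstarstar R)) -> \bar R} :=
  msum (fun i => dirac (nth point (nbr_seq q) i : borel (Gstarstar R))) (size (nbr_seq q)).

Lemma nbr_measureE q (A : set (borel (Gstarstar R))) :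
  nbr_measure q A = nbr_esum (fun z => (\1_A z)%:E) q.
Proof.
rewrite nbr_esum_seq => [|z]; last by rewrite lee_fin.
by rewrite (big_nth point) big_mkord.
Qed.

Lemma nbr_measure_fin_num q (A : set (borel (Gstarstar R))) :
  nbr_measure q A \is a fin_num.
Proof.
rewrite nbr_measureE nbr_esum_seq => [|z]; last by rewrite lee_fin.
by rewrite sumEFin.
Qed.

Lemma integral_nbr_measure q (T : Gstarstar R -> \bar R) :
  (forall z, 0 <= T z) -> measurable_fun [set: borel (Gstarstar R)] T ->
  \int[nbr_measure q]_z T z = nbr_esum T q.
Proof.
move=> T0 mT; rewrite ge0_integral_measure_sum // nbr_esum_seq // (big_nth point) big_mkord.
by apply: eq_bigr => i _; rewrite integral_dirac // diracT mul1e.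
Qed.

(** The isomorphism of (r+1)-balls maps neighbours of the root to neighbours of the root. The r-ball
    around (o, v) lies in the (r+1)-ball around o, so the isomorphism restricts to it. An injection
    is all that a lower bound on counts requires. *)
Lemma ball_iso_nbrs (q q' : Gstar R) (r : nat) :
  ball_iso r.+1 (representative q) (representative q') ->
  exists2 phi : vertex (representative q) -> vertex (representative q'),
    set_inj (nbrs (root1 (representative q))) phi &
    forall v, nbrs (root1 (representative q)) v ->
      nbrs (root1 (representative q')) (phi v) /\
      ball_iso r (representative (cls2 R (root1 (representative q)) v))
                 (representative (cls2 R (root1 (representative q')) (phi v))).
Proof.
move: (representative q) (representative q') => G G'.
have rE (K : rgraph 1) : root_seq K = [:: val (root1 K)].
  case: K => K s; rewrite /root_seq /root1 /= [in LHS](tuple_eta s) /=.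
  by case: (tupleP s) => a s'; rewrite tuple0.
rewrite /ball_iso !rE; set o := root1 G; set o' := root1 G' => -[f fi].
have [[fB' finj _] fadj [fo]] := fi.
have fB u : u \in vert (ball_graph G [:: val o] r.+1) ->
    f u \in vert (ball_graph G' [:: val o'] r.+1) by exact: fB'.
have nB v : nbrs o v -> val v \in vert (ball_graph G [:: val o] r.+1).
  move=> ov; apply/vert_ballP; split; first exact: valP.
  by exists (val o); rewrite ?mem_head //; exists [:: val v]; rewrite /= ov.
have oB : val o \in vert (ball_graph G [:: val o] r.+1).
  by apply: ball_root; rewrite ?mem_head // => u; rewrite inE => /eqP->; exact: valP.
have fV v : nbrs o v -> f (val v) \in vert G'.
  by move=> /nB/fB/vert_ballP[].
(* The default [o'] is taken only where f v is not a vertex of [G'], which does not happen for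
   neighbours of [o]. *)
pose phi (v : vertex G) : vertex G' := insubd o' (f (val v)).
have phiE v : nbrs o v -> val (phi v) = f (val v).
  by move=> /fV fv; rewrite insubdK.
have phiN v : nbrs o v -> nbrs o' (phi v).
  move=> ov; rewrite /nbrs /= phiE // -fo.
  have := fadj _ _ oB (nB _ ov); have foB := fB _ oB; have fvB := fB _ (nB _ ov).
  by rewrite (adj_ballE oB (nB _ ov)) (adj_ballE foB fvB) => ->.
exists phi.
- move=> u v; rewrite !inE => ou ov /(congr1 val); rewrite !phiE // => uv.
  by apply: val_inj; apply: finj uv; rewrite inE; exact: nB.
- move=> v ov; split; first exact: phiN.
  apply/ball_iso_class; rewrite /ball_iso /root_seq /= phiE // -fo.
  apply: (iso_ball_restrict (t := [:: val o; val v]) _ _ _ fi); try exact: induced_ball.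
  + by apply: ball_root => u; rewrite inE => /eqP->; exact: valP.
  + by move=> u; rewrite !inE => /orP[]/eqP->; [exact: oB|exact: nB].
  + exact: vert_ball_adj.
  + rewrite /= fo; apply: vert_ball_adj.
    by have := phiN _ ov; rewrite /nbrs /= phiE.
Qed.

(** Each neighbour v with [G,o,v] in [U] has a radius that secures membership in [U]. Local
    finiteness allows a common radius [r], and any rooted graph with the same (r+1)-ball then has at
    least as many neighbours counted by [U]. *)
Lemma open_nbr_measure (U : set (Gstarstar R)) (a : R) : open U ->
  open [set q | a%:E < nbr_measure q U].
Proof.
move=> /open_rspaceP oU; apply/open_rspaceP => q /= aq.
set G := representative q in aq *; set o := root1 G.
have fN := @lgraph_finite G o.
have /choice[r_ rP] : forall v : vertex G, exists r, U (cls2 R o v) -> forall z',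
    ball_iso r (representative (cls2 R o v)) (representative z') -> U z'.
  move=> v; have [/oU[r rU]|nU] := pselect (U (cls2 R o v)); first by exists r.
  by exists 0%N.
pose r := (\max_(v <- finmap.enum_fset (fset_set (nbrs o))) r_ v)%N.
have r_le v : nbrs o v -> (r_ v <= r)%N.
  move=> ov; apply: leq_bigmax_seq => //.
  by have := in_fset_set fN v; rewrite mem_set.
exists r.+1 => q' /ball_iso_nbrs[phi phi_inj phiP].
apply: lt_le_trans aq _; rewrite !nbr_measureE /nbr_esum -/G -/o.
set o' := root1 _.
have T0 z : 0 <= ((\1_U z)%:E : \bar R) by rewrite lee_fin.
apply: (@le_trans _ _ (\esum_(v in phi @` nbrs o) (\1_U (cls2 R o' v))%:E)).
  rewrite (reindex_esum (nbrs o) _ phi); last by split=> //; move=> v; exists v.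
  apply: le_esum => v ov; rewrite lee_fin !indicE.
  have [vU|_] := boolP (cls2 R o v \in U); last by [].
  rewrite mem_set //; rewrite inE in vU; apply: (rP v vU).
  by have [_] := phiP v ov; apply: ball_iso_le; exact: r_le.
rewrite [leLHS]esum_mkcond [leRHS]esum_mkcond; apply: le_esum => v _.
case: ifPn => [/set_mem[w ow <-]|_]; last by case: ifPn.
by rewrite ifT //; apply/mem_set; have [] := phiP w ow.
Qed.

Lemma measurable_nbr_measure (A : set (borel (Gstarstar R))) : measurable A ->
  measurable_fun [set: borel (Gstar R)] (fun q => nbr_measure q A).
Proof.
move=> mA; move: mA.
apply: (@dynkin_induction _ (borel (Gstarstar R)) (@open _)
  (fun A => measurable_fun [set: borel (Gstar R)] (fun q => nbr_measure q A))) => //.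
- by move=> U V; exact: openI.
- by apply: lower_semicontinuous_borel => a; apply: open_nbr_measure; exact: openT.
- by move=> U oU; apply: lower_semicontinuous_borel => a; exact: open_nbr_measure.
- move=> S mS fS.
  (* The subtraction is legitimate because the total mass, the degree of the root, is finite. *)
  have -> : (fun q => nbr_measure q (~` S)) =
            (fun q => nbr_measure q [set: borel (Gstarstar R)] - nbr_measure q S).
    apply/funext => q; rewrite -(setvU S) measureU //; last 2 first.
    - exact: measurableC.
    - by rewrite setICl.
    by rewrite addeK // nbr_measure_fin_num.
  apply: emeasurable_funB => //.
  by apply: lower_semicontinuous_borel => a; apply: open_nbr_measure; exact: openT.
- move=> F mF tF mnF.
  have -> : (fun q => nbr_measure q (\bigcup_k F k)) =
            (fun q => \sum_(k <oo | k \in setT) nbr_measure q (F k)).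
    by apply/funext => q; rewrite measure_bigcup.
  exact: ge0_emeasurable_sum.
Qed.

Lemma measurable_nbr_esum (T : Gstarstar R -> \bar R) :
  (forall z, 0 <= T z) -> measurable_fun [set: borel (Gstarstar R)] T ->
  measurable_fun [set: borel (Gstar R)] (nbr_esum T).
Proof.
move=> T0 mT.
have -> : nbr_esum T = (fun q => \int[nbr_measure q]_z T z).
  by apply/funext => q; rewrite integral_nbr_measure.
exact: (measurable_fun_integral_kernel measurable_nbr_measure T0 mT).
Qed.

End NeighbourSum.

(** * Integrability and mass transport *)

Section Domination.
Context d (T : measurableType d) (R : realType) (mu : {measure set T -> \bar R}).
Local Open Scope ereal_scope.

(* Without measurability the integral is a lower integral, which is still monotone. *)
Lemma ge0_le_integralT (f g : T -> \bar R) :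
  (forall t, 0 <= f t) -> (forall t, f t <= g t) ->
  \int[mu]_t f t <= \int[mu]_t g t.
Proof.
move=> f0 fg; have g0 t : 0 <= g t by exact: le_trans (f0 t) (fg t).
rewrite !ge0_integralTE //; apply: ereal_sup_le => _ [h /= hf <-].
by exists h => // t; exact: le_trans (hf t) (fg t).
Qed.

Lemma integrable_dominated (F u g : T -> R) :
  measurable_fun setT F -> measurable_fun setT u ->
  (forall t, 0 <= u t)%R -> \int[mu]_t (u t)%:E < +oo ->
  (forall t, 0 <= g t)%R -> \int[mu]_t (g t)%:E < +oo ->
  {ae mu, forall t, (`|F t| <= u t + g t)%R} ->
  mu.-integrable setT (EFin \o F).
Proof.
move=> mF mu_ u0 iu g0 ig [N [mN N0 FN]].
(* [v] is the measurable excess of |F| over [u]. Cutting it off on the null set [N] makes v <= g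
   hold everywhere, which the pointwise comparison of lower integrals requires. *)
pose v t := (Num.max 0 (`|F t| - u t) * \1_(~` N) t)%R.
have v0 t : (0 <= v t)%R by rewrite mulr_ge0 // le_max lexx.
have mv : measurable_fun setT v.
  apply: measurable_funM; last by apply: measurable_indic; exact: measurableC.
  apply: measurable_maxr; first exact: measurable_cst.
  by apply: measurable_funB => //; apply: measurableT_comp.
have Fle t : ~ N t -> (`|F t| <= u t + g t)%R.
  by move=> Nt; apply: contrapT => h; exact/Nt/FN.
have vg t : (v t <= g t)%R.
  rewrite /v indicE; have [/set_mem/Fle h|_] := boolP (t \in ~` N); last by rewrite mulr0.
  by rewrite mulr1 ge_max g0 lerBlDl.
have Fuv : {ae mu, forall t, setT t -> `|(F t)%:E| <= (u t)%:E + (v t)%:E}.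
  exists N; split => // t /= h; apply: contrapT => Nt; apply: h => _.
  rewrite -EFinD lee_fin /v indicE mem_set // mulr1 -lerBlDl.
  by rewrite le_max lexx orbT.
apply/integrableP; split; first exact/measurable_EFinP.
apply: (@le_lt_trans _ _ (\int[mu]_t ((u t)%:E + (v t)%:E))).
  apply: ae_ge0_le_integral => //.
  - by apply: measurableT_comp => //; exact/measurable_EFinP.
  - by move=> t _; rewrite adde_ge0 ?lee_fin.
  - by apply: emeasurable_funD; exact/measurable_EFinP.
rewrite ge0_integralD //; try exact/measurable_EFinP.
- rewrite lte_add_pinfty //; apply: le_lt_trans ig.
  by apply: ge0_le_integralT => t; rewrite lee_fin.
- by move=> t _; rewrite lee_fin.
- by move=> t _; rewrite lee_fin.
Qed.

Lemma integral_ltyP (F : T -> R) : (forall t, 0 <= F t)%R -> measurable_fun setT F ->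
  mu.-integrable setT (EFin \o F) <-> \int[mu]_t (F t)%:E < +oo.
Proof.
move=> F0 mF.
have E : \int[mu]_t `|(EFin \o F) t| = \int[mu]_t (F t)%:E.
  by apply: eq_integral => t _; rewrite /= ger0_norm.
split=> [/integrableP[_]|h]; first by rewrite E.
by apply/integrableP; split; [exact/measurable_EFinP|rewrite E].
Qed.

End Domination.

Section MassTransport.
Variables (R : realType) (mu : probability (borel (Gstar R)) R).
Hypothesis hmu : unimodular mu.
Local Open Scope ereal_scope.

Lemma measurable_class1 :
  @measurable_fun _ _ (borel (Gstarstar R)) (borel (Gstar R)) setT (@class1 R).
Proof. by apply: continuous_borel; case: (root_maps_continuous R). Qed.

Lemma measurable_class2 :
  @measurable_fun _ _ (borel (Gstarstar R)) (borel (Gstar R)) setT (@class2 R).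
Proof. by apply: continuous_borel; case: (root_maps_continuous R). Qed.

Lemma measurable_swap_roots :
  @measurable_fun _ _ (borel (Gstarstar R)) (borel (Gstarstar R)) setT (@swap_roots R).
Proof. by apply: continuous_borel; case: (root_maps_continuous R). Qed.

(** Unimodularity is applied to [T] cut off outside the open set [root_edges], which turns sums over
    all vertices into sums over neighbours. Adjacency is symmetric, so the cut-off survives the
    swap. *)
Lemma mass_transport (T : Gstarstar R -> \bar R) :
  (forall z, 0 <= T z) -> measurable_fun [set: borel (Gstarstar R)] T ->
  \int[mu]_q nbr_esum T q = \int[mu]_q nbr_esum (T \o @swap_roots R) q.
Proof.
move=> T0 mT; have madj : measurable (@root_edges R : set (borel (Gstarstar R))).
  by apply: borel_open; case: (root_maps_continuous R).
have h := hmu; rewrite /unimodular in h; have {}h := h (T \_ (@root_edges R)).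
transitivity (\int[mu]_q sum_vertices (fun G o v => (T \_ (@root_edges R)) (cls2 R o v)) q).
  apply: eq_integral => q _; rewrite /nbr_esum /sum_vertices esum_mkcond.
  apply: eq_esum => v _; rewrite patchE.
  by congr (if _ then _ else _); apply/asbool_equiv_eq; split=> /root_edgesE.
rewrite h; last 2 first.
- by apply/(measurable_restrictT _ _).1 => //; exact: measurable_funTS.
- by move=> z; rewrite patchE; case: ifP.
apply: eq_integral => q _; rewrite /nbr_esum esum_mkcond.
apply: eq_esum => v _; rewrite patchE /= swap_rootsE.
congr (if _ then _ else _); apply/asbool_equiv_eq; split.
  by move=> /root_edgesE/nbrs_sym.
by move=> /nbrs_sym/root_edgesE.
Qed.

(** A null set of roots stays null after one step along an edge: by mass transport, the expected
    number of neighbours lying in [N] is the integral of the degree over [N], that is 0. *)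
Lemma ae_nbrs (P : forall G : lgraph, vertex G -> Prop) : ae_rooted mu P ->
  ae_rooted mu (fun G o => forall v : vertex G, nbrs o v -> P G v).
Proof.
move=> [N [mN N0 PN]].
pose T : Gstarstar R -> \bar R := fun z => (\1_N (class2 z))%:E.
have T0 z : 0 <= T z by rewrite lee_fin.
have mT : measurable_fun [set: borel (Gstarstar R)] T.
  apply/measurable_EFinP; apply: (measurableT_comp _ measurable_class2).
  exact: measurable_indic.
have mS : measurable_fun [set: borel (Gstarstar R)] (T \o @swap_roots R).
  exact: measurableT_comp mT measurable_swap_roots.
have S0 z : 0 <= (T \o @swap_roots R) z by exact: T0.
have : \int[mu]_q nbr_esum T q = 0.
  rewrite mass_transport //.
  have -> : 0 = \int[mu]_q (cst 0 : borel (Gstar R) -> \bar R) q by rewrite integral0.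
  apply: ge0_ae_eq_integral => //.
  - exact: measurable_nbr_esum.
  - by move=> q _; apply: esum_ge0.
  - exists N; split => // q /= h; apply: contrapT => Nq; apply: h => _.
    rewrite /nbr_esum esum1 // => v _; rewrite /T /= swap_rootsE class2E cls_root.
    by rewrite indicE memNset.
have -> : \int[mu]_q nbr_esum T q = \int[mu]_q `|nbr_esum T q|.
  by apply: eq_integral => q _; rewrite gee0_abs // esum_ge0.
move=> /(ae_eq_integral_abs _ _ (measurable_nbr_esum T0 mT)).1 h.
apply: filterS (h measurableT) => q /(_ I) qT G o oq v ov.
apply: contrapT => Pv; have Nv : N (cls R v) by apply: PN => /(_ G v erefl).
move: qT; rewrite -oq nbr_esumE /cst => q0.
suff : (1 : \bar R) <= 0 by rewrite leNgt lte01.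
(* One neighbour in [N] alone contributes 1 to the sum. *)
rewrite -[leRHS]q0; apply: esum_ge; exists [set v].
  by split; [exact: finite_set1|move=> _ ->].
by rewrite fsbig_set1 /T class2E indicE mem_set.
Qed.

End MassTransport.

(** * Real-valued sums over neighbours *)

Section RealNeighbourSum.
Variable R : realType.
Implicit Types (T : Gstarstar R -> R) (q : Gstar R).

Definition nbr_sum T q : R := sum_nbrs (fun G o v => T (cls2 R o v)) q.

Lemma nbr_sumE T q : nbr_sum T q = \sum_(z <- nbr_seq q) T z.
Proof.
have fN := @lgraph_finite (representative q) (root1 (representative q)).
by rewrite /nbr_sum /sum_nbrs /nbr_seq fsbig_finite // big_map.
Qed.

Lemma nbr_seqP q z : z \in nbr_seq q -> exists2 v,
  nbrs (root1 (representative q)) v & z = cls2 R (root1 (representative q)) v.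
Proof.
move=> /mapP[v vN ->]; exists v => //.
have fN := @lgraph_finite (representative q) (root1 (representative q)).
by move: vN; rewrite in_fset_set // => /set_mem.
Qed.

Lemma le_nbr_sum T1 T2 q :
  (forall v, nbrs (root1 (representative q)) v ->
    T1 (cls2 R (root1 (representative q)) v) <= T2 (cls2 R (root1 (representative q)) v)) ->
  nbr_sum T1 q <= nbr_sum T2 q.
Proof.
move=> T12; rewrite !nbr_sumE big_seq [leRHS]big_seq; apply: ler_sum => z.
by move=> /nbr_seqP[v ov ->]; exact: T12.
Qed.

Lemma nbr_sumD T1 T2 q : nbr_sum (fun z => T1 z + T2 z) q = nbr_sum T1 q + nbr_sum T2 q.
Proof. by rewrite !nbr_sumE big_split. Qed.

Lemma nbr_sumZ (c : R) T q : nbr_sum (fun z => c * T z) q = c * nbr_sum T q.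
Proof. by rewrite !nbr_sumE mulr_sumr. Qed.

Lemma nbr_sum_ge0 T q : (forall z, 0 <= T z) -> 0 <= nbr_sum T q.
Proof. by move=> T0; rewrite nbr_sumE sumr_ge0. Qed.

Lemma nbr_sum_norm T q : `|nbr_sum T q| <= nbr_sum (fun z => `|T z|) q.
Proof. by rewrite !nbr_sumE ler_norm_sum. Qed.

Lemma nbr_sum_EFin T q : (forall z, 0 <= T z) ->
  (nbr_sum T q)%:E = nbr_esum (fun z => (T z)%:E) q.
Proof.
move=> T0; rewrite nbr_esum_seq => [|z]; last by rewrite lee_fin.
by rewrite sumEFin nbr_sumE.
Qed.

Lemma nbr_sum_const_le (c : R) (D : nat) q : 0 <= c ->
  (nbrs (root1 (representative q)) #<= `I_D)%card ->
  nbr_sum (fun=> c) q <= D%:R * c.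
Proof.
move=> c0 cD; rewrite nbr_sumE big_const_seq count_predT iter_addr_0 -[c *+ _]mulr_natl.
rewrite ler_wpM2r // ler_nat size_map.
exact: geq_card_fset_set.
Qed.

Lemma measurable_nbr_sum T : @measurable_fun _ _ (borel (Gstarstar R)) R setT T ->
  @measurable_fun _ _ (borel (Gstar R)) R setT (nbr_sum T).
Proof.
move=> mT.
have nnT S : (forall z, 0 <= S z) -> @measurable_fun _ _ (borel (Gstarstar R)) R setT S ->
    @measurable_fun _ _ (borel (Gstar R)) R setT (nbr_sum S).
  move=> S0 mS; apply/measurable_EFinP.
  rewrite (_ : _ \o _ = nbr_esum (fun z => (S z)%:E)).
    by apply: measurable_nbr_esum => [z|]; [rewrite lee_fin|exact/measurable_EFinP].
  by apply/funext => q; rewrite /= nbr_sum_EFin.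
(* A signed [T] is the difference of the nonnegative functions T + |T| and |T|. *)
have -> : nbr_sum T = (fun q => nbr_sum (fun z => T z + `|T z|) q - nbr_sum (fun z => `|T z|) q).
  by apply/funext => q; rewrite nbr_sumD addrK.
have mnT : @measurable_fun _ _ (borel (Gstarstar R)) R setT (fun z => `|T z|).
  exact: measurableT_comp.
apply: measurable_funB; apply: nnT => //; last exact: measurable_funD.
by move=> z; rewrite -lerBlDl sub0r -normrN ler_norm.
Qed.

End RealNeighbourSum.

Section RealMassTransport.
Variables (R : realType) (mu : probability (borel (Gstar R)) R).
Hypothesis hmu : unimodular mu.

Lemma ae_rooted_rep (P : forall G : lgraph, vertex G -> Prop) : ae_rooted mu P ->
  {ae mu, forall q : borel (Gstar R),
    P (representative (q : Gstar R)) (root1 (representative (q : Gstar R)))}.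
Proof.
rewrite /ae_rooted => -[N [mN N0 PN]]; exists N; split => // q /= Pq.
by apply: PN => /(_ _ _ (cls_root q)).
Qed.

Lemma integral_nbr_sum_swap (T : Gstarstar R -> R) : (forall z, 0 <= T z) ->
  @measurable_fun _ _ (borel (Gstarstar R)) R setT T ->
  (\int[mu]_q (nbr_sum T q)%:E = \int[mu]_q (nbr_sum (T \o @swap_roots R) q)%:E)%E.
Proof.
move=> T0 mT; under eq_integral do rewrite nbr_sum_EFin //.
rewrite (mass_transport hmu) => [|z|]; last 2 first.
- by rewrite lee_fin.
- exact/measurable_EFinP.
by apply: eq_integral => q _; rewrite nbr_sum_EFin // => z; exact: T0.
Qed.

Lemma integrable_nbr_sum_swap (T : Gstarstar R -> R) : (forall z, 0 <= T z) ->
  @measurable_fun _ _ (borel (Gstarstar R)) R setT T ->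
  mu.-integrable setT (EFin \o nbr_sum (T \o @swap_roots R)) ->
  mu.-integrable setT (EFin \o nbr_sum T).
Proof.
move=> T0 mT.
have mTs := measurableT_comp mT (@measurable_swap_roots R).
have h1 := @integral_ltyP _ _ _ mu (nbr_sum T) (fun q => nbr_sum_ge0 q T0)
  (measurable_nbr_sum mT).
have h2 := @integral_ltyP _ _ _ mu (nbr_sum (T \o @swap_roots R))
  (fun q => nbr_sum_ge0 q (fun z => T0 _)) (measurable_nbr_sum mTs).
by move=> /h2 h; apply/h1; rewrite integral_nbr_sum_swap.
Qed.

(** All terms of the sum equal n([G,o]), so the sum is the degree times n and at most D n. *)
Lemma integrable_nbr_sum_class1 (n : Gstar R -> R) : bounded_degree mu ->
  (forall q, 0 <= n q) -> @measurable_fun _ _ (borel (Gstar R)) R setT n ->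
  mu.-integrable setT (EFin \o n) ->
  mu.-integrable setT (EFin \o nbr_sum (n \o @class1 R)).
Proof.
move=> [D hD] n0 mn /(integral_ltyP mu n0 mn) intn.
apply: (@integrable_dominated _ _ _ mu _ (fun q => D%:R * n q) (fun=> 0)) => //.
- by apply: measurable_nbr_sum; exact: (measurableT_comp mn (@measurable_class1 R)).
- exact: measurable_funM.
- by move=> q; rewrite mulr_ge0.
- under eq_integral do rewrite EFinM.
  rewrite ge0_integralZl_EFin //; first by rewrite lte_mul_pinfty ?lee_fin.
  + by move=> q _; rewrite lee_fin.
  + exact/measurable_EFinP.
- by rewrite integral0.
- apply: filterS (ae_rooted_rep hD) => q /(_ (root1 (representative q))) hq.
  rewrite ger0_norm; last by apply: nbr_sum_ge0 => z; exact: n0.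
  rewrite addr0; apply: le_trans (nbr_sum_const_le (n0 q) hq).
  by apply: le_nbr_sum => v _; rewrite /= class1E cls_root.
Qed.

End RealMassTransport.

Section RealIntegrable.
Context d (T : measurableType d) (R : realType) (mu : {measure set T -> \bar R}).

Lemma integrable_realD (F G : T -> R) : mu.-integrable setT (EFin \o F) ->
  mu.-integrable setT (EFin \o G) -> mu.-integrable setT (EFin \o (fun t => F t + G t)).
Proof. by move=> iF iG; exact: (integrableD measurableT iF iG). Qed.

Lemma integrable_realZ (c : R) (F : T -> R) : mu.-integrable setT (EFin \o F) ->
  mu.-integrable setT (EFin \o (fun t => c * F t)).
Proof. by move=> iF; exact: (integrableZl measurableT c iF). Qed.

Lemma integrable_real_dominated (F u g : T -> R) :
  measurable_fun setT F -> mu.-integrable setT (EFin \o u) ->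
  (forall t, 0 <= u t) -> (forall t, 0 <= g t) -> (\int[mu]_t (g t)%:E < +oo)%E ->
  {ae mu, forall t, `|F t| <= u t + g t} ->
  mu.-integrable setT (EFin \o F).
Proof.
move=> mF iu u0 g0 ig h.
have mu_ : measurable_fun setT u by exact/measurable_EFinP/(measurable_int mu iu).
exact: (integrable_dominated mF mu_ u0 ((integral_ltyP mu u0 mu_).1 iu) g0 ig h).
Qed.

End RealIntegrable.

Section SquareDistance.
Variables (R : realType) (H : completeNormedModType R).
Variables (mu : probability (borel (Gstar R)) R) (x : Gstar R -> H) (a : H).
Hypothesis hx : square_integrable mu x.

Let sqdist (q : Gstar R) : R := `|x q - a| ^+ 2.

Lemma measurable_sqdist : @measurable_fun _ _ (borel (Gstar R)) R setT sqdist.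
Proof.
have c : continuous (fun y : H => `|y - a| ^+ 2).
  move=> y; under eq_fun do rewrite expr2.
  apply: cvgM; apply: cvg_norm; apply: cvgB => //; exact: cvg_cst.
exact: (measurableT_comp (continuous_borel_real c) hx.1).
Qed.

Lemma integrable_sqdist : mu.-integrable setT (EFin \o sqdist).
Proof.
have [mx ix] := hx.
have mn : @measurable_fun _ _ (borel (Gstar R)) R setT (fun q => `|x q| ^+ 2).
  have c : continuous (fun y : H => `|y| ^+ 2).
    move=> y; under eq_fun do rewrite expr2.
    by apply: cvgM; exact: cvg_norm.
  exact: (measurableT_comp (continuous_borel_real c) mx).
have i1 : mu.-integrable setT (EFin \o (fun q => `|x q| ^+ 2)).
  by apply/integral_ltyP => // q; exact: sqr_ge0.
(* The majorant is 2 |x|^2 + 2 |a|^2; the constant is integrable because [mu] is finite. *)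
have i2 := integrable_realD (integrable_realZ 2 i1)
  (finite_measure_integrable_cst mu (2 * `|a| ^+ 2) measurableT).
apply: le_integrable i2 => //; first by apply/measurable_EFinP; exact: measurable_sqdist.
move=> q _; rewrite /= lee_fin ger0_norm ?sqr_ge0 //.
apply: le_trans (ler_norm _); rewrite /sqdist.
have := ler_normB (x q) a; have := normr_ge0 (x q - a).
have := sqr_ge0 (`|x q| - `|a|); nra.
Qed.

End SquareDistance.

(** * Integrability of the private and interaction costs *)

Section Admissible.
Variables (R : realType) (H : completeNormedModType R).
Variables (dot : {dot H for idfun}) (hH : separable_hilbert dot).
Variables (mu : probability (borel (Gstar R)) R).
Hypotheses (hmu : unimodular mu) (hD : bounded_degree mu).
Variables (f : Gstar R -> H -> R) (h psi : Gstarstar R -> H -> H -> R).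
Hypothesis hadm : admissible dot mu f h psi.
Variable x : Gstar R -> H.
Hypothesis hx : square_integrable mu x.

Let mx1 : @measurable_fun _ _ (borel (Gstarstar R)) (borel H) setT (x \o @class1 R).
Proof. exact: (measurableT_comp hx.1 (@measurable_class1 R)). Qed.

Let mx2 : @measurable_fun _ _ (borel (Gstarstar R)) (borel H) setT (x \o @class2 R).
Proof. exact: (measurableT_comp hx.1 (@measurable_class2 R)). Qed.

Lemma measurable_psi (b c : Gstarstar R -> H) :
  @measurable_fun _ _ (borel (Gstarstar R)) (borel H) setT b ->
  @measurable_fun _ _ (borel (Gstarstar R)) (borel H) setT c ->
  @measurable_fun _ _ (borel (Gstarstar R)) R setT (fun z => psi z (b z) (c z)).
Proof.
move=> mb mc.
apply: (measurableT_comp (admissible_measurable_psi hadm)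
  (g := fun z : borel (Gstarstar R) => (z, b z : borel H, c z : borel H))).
apply: measurable_fun_pair => //; exact: measurable_fun_pair.
Qed.

(** Separates the distance p, which is measurable in the applications, from the gradient norm g,
    giving the form u + g of [integrable_dominated]. *)
Lemma mul_le_sqr (p g L : R) : p * (g + L * p) <= (1 + L) * p ^+ 2 + g ^+ 2.
Proof. have := sqr_ge0 (p - g); have := sqr_ge0 (p + g); nra. Qed.

Lemma integrable_private_cost :
  mu.-integrable setT (EFin \o (fun q => f q (x q))).
Proof.
have [Lf [Lh [Lf0 _ lip]]] := admissible_lipschitz hadm.
have [a [ifa igf _ _]] := admissible_integrable hadm.
have mfx (y : Gstar R -> H) : @measurable_fun _ _ (borel (Gstar R)) (borel H) setT y ->
    @measurable_fun _ _ (borel (Gstar R)) R setT (fun q => f q (y q)).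
  move=> my; apply: (measurableT_comp (admissible_measurable_f hadm)
    (g := fun q : borel (Gstar R) => (q, y q : borel H))).
  exact: measurable_fun_pair.
have mfa := mfx (fun=> a) (measurable_cst _).
have ia : mu.-integrable setT (EFin \o (fun q => `|f q a|)).
  apply/integral_ltyP => //; exact: measurableT_comp.
have iu := integrable_realD ia (integrable_realZ (1 + Lf) (integrable_sqdist a hx)).
apply: (integrable_real_dominated (mfx _ hx.1) iu _ _ igf).
- by move=> q; rewrite addr_ge0 // mulr_ge0 // ?addr_ge0 // sqr_ge0.
- by move=> q; exact: sqr_ge0.
apply: filterS2 (ae_rooted_rep (admissible_diff_f hadm)) (ae_rooted_rep lip) => q.
rewrite cls_root => df [lf _].
have := @gradient_lipschitz_bound _ _ _ hH (f q) Lf a (x q) Lf0 df (fun c => lf c a).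
have := mul_le_sqr (`|x q - a|) (`|grad dot f q a|) Lf; rewrite -/(grad dot f q a).
have := ler_normD (f q (x q) - f q a) (f q a); rewrite subrK; lra.
Qed.


Let square_grad_h a (q : Gstar R) : R :=
  sum_nbrs (fun G o v => `|grad1 dot h (cls2 R o v) a a| ^+ 2) q.

Lemma integrable_nbr_sqdist a :
  mu.-integrable setT (EFin \o nbr_sum (fun z => `|x (class1 z) - a| ^+ 2)) /\
  mu.-integrable setT (EFin \o nbr_sum (fun z => `|x (class2 z) - a| ^+ 2)).
Proof.
have mn := measurable_sqdist a hx.
have i1 := integrable_nbr_sum_class1 hD (fun q => sqr_ge0 _) mn (integrable_sqdist a hx).
split; first exact: i1.
apply: (integrable_nbr_sum_swap hmu) => [z||]; first exact: sqr_ge0.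
  exact: (measurableT_comp mn (@measurable_class2 R)).
(* The swap turns |x([G,v]) - a|^2 into |x([G,o]) - a|^2, already treated by the degree bound. *)
rewrite (_ : _ \o _ = (fun z => `|x (class1 z) - a| ^+ 2)); first exact: i1.
by apply/funext => z; rewrite /= /swap_roots class2E.
Qed.

Lemma square_grad_h_ge0 a q : 0 <= square_grad_h a q.
Proof.
by apply: (@nbr_sum_ge0 _ (fun z => `|grad1 dot h z a a| ^+ 2)) => z; exact: sqr_ge0.
Qed.

Lemma integrable_nbr_increment1 a :
  (\int[mu]_q (square_grad_h a q)%:E < +oo)%E ->
  mu.-integrable setT (EFin \o nbr_sum (fun z =>
    `|psi z (x (class1 z)) (x (class2 z)) - psi z a (x (class2 z))|)).
Proof.
move=> ig; have [Lf [Lh [_ Lh0 lip]]] := admissible_lipschitz hadm.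
have [i1 i2] := integrable_nbr_sqdist a.
have mT : @measurable_fun _ _ (borel (Gstarstar R)) R setT (fun z =>
    `|psi z (x (class1 z)) (x (class2 z)) - psi z a (x (class2 z))|).
  apply: measurableT_comp => //; apply: measurable_funB; apply: measurable_psi => //.
(* With p = |x([G,o]) - a|, r = |x([G,v]) - a| and G0 the norm of the gradient at (a, a), each term
   is at most p (Lh r + G0 + Lh p). Since p r <= p^2 + r^2 and p G0 <= p^2 + G0^2, this is at most
   (1 + 2 Lh) p^2 + Lh r^2 + G0^2. *)
have iu := integrable_realD (integrable_realZ (1 + 2 * Lh) i1) (integrable_realZ Lh i2).
apply: (integrable_real_dominated (measurable_nbr_sum mT) iu _ (square_grad_h_ge0 a) ig).
  move=> q; rewrite addr_ge0 // mulr_ge0 ?addr_ge0 ?mulr_ge0 //;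
    by apply: nbr_sum_ge0 => z; exact: sqr_ge0.
apply: filterS2 (ae_rooted_rep (admissible_diff_h_psi hadm))
  (ae_rooted_rep lip) => q dpsi [_ lip_h].
rewrite ger0_norm; last exact: nbr_sum_ge0.
rewrite -!nbr_sumZ -nbr_sumD -(nbr_sumD _ (fun z => `|grad1 dot h z a a| ^+ 2)).
apply: le_nbr_sum => v ov; rewrite class1E class2E.
set o := root1 _ in ov *; have [_ dF grads] := dpsi v ov.
set b := x (cls R v); set z := cls2 R o v.
have gradE c : gradient dot (fun a' => psi z a' b) c = grad1 dot h z c b.
  by have [] := grads c b.
have := @gradient_lipschitz_bound _ _ _ hH (fun a' => psi z a' b) Lh a (x (cls R o)) Lh0
  (fun c => gateaux_partial1 (dF (c, b))).
rewrite !gradE => bound; apply: le_trans (bound _) _.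
  move=> c; rewrite !gradE; apply: le_trans (lip_h v ov _ _ _ _) _.
  by rewrite subrr normr0 addr0.
(* Moving the base point of the gradient from (a, b) to (a, a), where it is square integrable, costs
   Lh |b - a|. *)
have := lip_h v ov a a b a; rewrite subrr normr0 add0r => lip_b.
have := ler_normD (grad1 dot h z a b - grad1 dot h z a a) (grad1 dot h z a a).
rewrite subrK.
move: lip_b.
move: (grad1 dot h z a b) => g; move: `|g - _| => g' => lip_b tri.
have p0 := normr_ge0 (x (cls R o) - a); have r0 := normr_ge0 (b - a).
have := normr_ge0 (grad1 dot h z a a).
move: `|g| `|_ - a| `|b - a| `|grad1 dot h z a a| lip_b tri p0 r0 => G p r G0.
move=> h1 h2 p0 r0 G00.
apply: (@le_trans _ _ (p * (Lh * r + G0 + Lh * p))).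
  by rewrite ler_wpM2l //; lra.
have := mulr_ge0 Lh0 (sqr_ge0 (p - r)); have := sqr_ge0 (p - G0);
have := mulr_ge0 Lh0 (sqr_ge0 p);
have := mulr_ge0 Lh0 (sqr_ge0 r); have := sqr_ge0 p; have := sqr_ge0 G0; lra.
Qed.

Lemma integrable_nbr_increment2 a :
  (\int[mu]_q (square_grad_h a q)%:E < +oo)%E ->
  mu.-integrable setT (EFin \o nbr_sum (fun z =>
    `|psi z a (x (class2 z)) - psi z a a|)).
Proof.
move=> ig; have [Lf [Lh [_ Lh0 lip]]] := admissible_lipschitz hadm.
have [i1 _] := integrable_nbr_sqdist a.
have mT : @measurable_fun _ _ (borel (Gstarstar R)) R setT (fun z =>
    `|psi z a (x (class2 z)) - psi z a a|).
  apply: measurableT_comp => //; apply: measurable_funB; apply: measurable_psi => //.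
(* After the swap the varying argument is x([G,o]), in the second slot of [psi] at [G,v,o]; the
   gradient there is that of [h] at [G,o,v], controlled by (iv). *)
apply: (integrable_nbr_sum_swap hmu) => //.
have mTs := measurableT_comp mT (@measurable_swap_roots R).
have iu := integrable_realZ (1 + Lh) i1.
apply: (integrable_real_dominated (measurable_nbr_sum mTs) iu _ (square_grad_h_ge0 a) ig).
  move=> q; rewrite mulr_ge0 ?addr_ge0 //.
  by apply: nbr_sum_ge0 => z; exact: sqr_ge0.
(* The edge is now read from [v] to [o], so condition (ii) is needed at the neighbour [v]; the
   Lipschitz bound still concerns the root [o]. *)
apply: filterS2 (ae_rooted_rep (ae_nbrs hmu (admissible_diff_h_psi hadm)))
  (ae_rooted_rep lip) => q dpsi [_ lip_h].
rewrite ger0_norm; last by apply: nbr_sum_ge0 => z; exact: normr_ge0.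
rewrite -!nbr_sumZ -(nbr_sumD _ (fun z => `|grad1 dot h z a a| ^+ 2)).
apply: le_nbr_sum => v ov; rewrite /= swap_rootsE class1E class2E.
set o := root1 _ in ov *; have [_ dF grads] := dpsi v ov o ((nbrs_sym o v).1 ov).
set b := x (cls R o); set z := cls2 R v o; set z' := cls2 R o v.
have gradE c : gradient dot (fun b' => psi z a b') c = grad1 dot h z' c a.
  by have [] := grads a c.
have := @gradient_lipschitz_bound _ _ _ hH (fun b' => psi z a b') Lh a b Lh0
  (fun c => gateaux_partial2 (dF (a, c))).
rewrite !gradE => bound; apply: le_trans (bound _) _; last exact: mul_le_sqr.
move=> c; rewrite !gradE; apply: le_trans (lip_h v ov _ _ _ _) _.
by rewrite subrr normr0 addr0.
Qed.

Lemma integrable_interaction :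
  mu.-integrable setT (EFin \o nbr_sum (fun z => psi z (x (class1 z)) (x (class2 z)))).
Proof.
have [a [_ _ ipsi ig]] := admissible_integrable hadm.
have mpsi : @measurable_fun _ _ (borel (Gstarstar R)) R setT (fun z => `|psi z a a|).
  by apply: measurableT_comp => //; exact: measurable_psi.
have i3 : mu.-integrable setT (EFin \o nbr_sum (fun z => `|psi z a a|)).
  apply/integral_ltyP => //; last exact: measurable_nbr_sum.
  by move=> q; exact: nbr_sum_ge0.
(* The majorant comes from telescoping psi(x o, x v) through psi(a, x v) and psi(a, a). *)
have iS := integrable_realD (integrable_nbr_increment1 ig)
  (integrable_realD (integrable_nbr_increment2 ig) i3).
apply: le_integrable iS => //.
  by apply/measurable_EFinP; apply: measurable_nbr_sum; exact: measurable_psi.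
move=> q _; rewrite /= lee_fin -!nbr_sumD; apply: le_trans (ler_norm _).
apply: le_trans (nbr_sum_norm _ _) _; apply: le_nbr_sum => v _.
set z := cls2 R _ _; set b := x (class1 z); set c := x (class2 z).
have := ler_normD (psi z b c - psi z a c) (psi z a c).
have := ler_normD (psi z a c - psi z a a) (psi z a a).
rewrite !subrK; lra.
Qed.

End Admissible.

Theorem proposition3p1 (R : realType) (H : completeNormedModType R)
    (dot : {dot H for idfun}) (hH : separable_hilbert dot)
    (mu : probability (borel (Gstar R)) R)
    (hmu : unimodular mu) (hD : bounded_degree mu)
    (f : Gstar R -> H -> R) (h psi : Gstarstar R -> H -> H -> R)
    (hadm : admissible dot mu f h psi)
    (x : Gstar R -> H) (hx : square_integrable mu x) :
  mu.-integrable setT (fun q => (potential_integrand f psi x q)%:E) /\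
  potential mu f psi x \is a fin_num.
Proof.
have iP : mu.-integrable setT (fun q => (potential_integrand f psi x q)%:E).
  have i1 := integrable_private_cost hH hadm hx.
  have i2 := integrable_realZ 2^-1 (integrable_interaction hH hmu hD hadm hx).
  rewrite (_ : (fun q => _) = EFin \o (fun q => f q (x q) +
      2^-1 * nbr_sum (fun z => psi z (x (class1 z)) (x (class2 z))) q)).
    exact: integrable_realD i1 i2.
  apply/funext => q; rewrite /potential_integrand /nbr_sum /=.
  congr (_ + _ * sum_nbrs _ q)%:E.
  by apply: functional_extensionality_dep => G; apply/funext => o; apply/funext => v;
    rewrite class1E class2E.
split; first exact: iP.
exact: (integrable_fin_num measurableT iP).
Qed.
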